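(* There exist absolute constants $c,c'>0$ (not depending on $n,\sigma,\boldsymbol\mu,\delta$) such that the following holds. Let $n\ge 3$, $\sigma>0$, $\boldsymbol\mu\in\mathbb{R}^n$, and let $\mathbf{y}=\boldsymbol\mu+\boldsymbol\xi$ where $\boldsymbol\xi$ has distribution $\mathcal{N}(0,\sigma^2 I_{n\times n})$. Let $\hat{\boldsymbol\mu}^{Q-conv}$ be the estimator defined in the context. Then for all $\delta\in(0,1/3)$, with probability at least $1-3\delta$, $$\|\hat{\boldsymbol\mu}^{Q-conv}-\boldsymbol\mu\|^2\le \min_{\boldsymbol u\in\mathbb{R}^n}\left(\|\boldsymbol\mu-\boldsymbol u\|^2+\frac{c\,\sigma^2 q(\boldsymbol u)}{n}\log\frac{en}{q(\boldsymbol u)}\right)+\frac{c\,\sigma^2\log(1/\delta)}{n},$$ and moreover $$\mathbb{E}_{\boldsymbol\mu}\|\hat{\boldsymbol\mu}^{Q-conv}-\boldsymbol\mu\|^2\le \min_{\boldsymbol u\in\mathbb{R}^n}\left(\|\boldsymbol\mu-\boldsymbol u\|^2+\frac{c'\sigma^2 q(\boldsymbol u)}{n}\log\frac{en}{q(\boldsymbol u)}\right).$$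
   Context: Norm: $\|\boldsymbol u\|^2=\frac1n\sum_{i=1}^n u_i^2$ for $\boldsymbol u\in\mathbb{R}^n$ (scaled Euclidean norm). $\mathbb{E}_{\boldsymbol\mu}$ is the expectation with respect to the distribution of $\mathbf{y}=\boldsymbol\mu+\boldsymbol\xi$. For $\boldsymbol u\in\mathbb{R}^n$, $q(\boldsymbol u)\ge1$ is the integer such that $q(\boldsymbol u)-1$ is the cardinality of $\{i\in\{2,\dots,n-1\}: 2u_i\ne u_{i+1}+u_{i-1}\}$. Estimator $\hat{\boldsymbol\mu}^{Q-conv}$ (a function of $\mathbf{y}$, with $\sigma$ known): for every $J\subseteq\{2,\dots,n-1\}$ (including $J=\emptyset$) let $$\nu_J=\frac{\exp(-|J|)}{H_C\binom{n-2}{|J|}},\qquad H_C=\sum_{i=0}^{n-2}\exp(-i),$$ let $W_J=\{\boldsymbol u\in\mathbb{R}^n:\ 2u_i=u_{i+1}+u_{i-1}\ \text{for all } i\in\{2,\dots,n-1\}\setminus J\}$, and let $Q_J\in\mathbb{R}^{n\times n}$ be the orthogonal projector onto $W_J$. For $\boldsymbol\theta=(\theta_J)_{J\subseteq\{2,\dots,n-1\}}$ with real entries put $\boldsymbol\mu_{\boldsymbol\theta}=\sum_{J}\theta_J Q_J\mathbf{y}$. Let $\Lambda'=\{\boldsymbol\theta:\ \theta_J\ge0\ \text{for all }J,\ \sum_J\theta_J=1\}$. Then $\hat{\boldsymbol\mu}^{Q-conv}=\boldsymbol\mu_{\hat{\boldsymbol\theta}}$, where $\hat{\boldsymbol\theta}$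 is a minimizer over $\boldsymbol\theta\in\Lambda'$ of $$\|\boldsymbol\mu_{\boldsymbol\theta}-\mathbf{y}\|^2+\sum_{J\subseteq\{2,\dots,n-1\}}\theta_J\left(\frac{2\sigma^2|J|}{n}+\frac12\|\boldsymbol\mu_{\boldsymbol\theta}-Q_J\mathbf{y}\|^2+\frac{46\sigma^2}{n}\log\frac1{\nu_J}\right).$$ *)

(* Defs.v *)
From HB Require Import structures.
From mathcomp Require Export all_boot all_order all_algebra.
From mathcomp Require Export all_classical all_reals all_analysis.

Set Implicit Arguments.
Unset Strict Implicit.
Unset Printing Implicit Defensive.

Import Order.TTheory GRing.Theory Num.Theory.
Import numFieldNormedType.Exports.

Local Open Scope classical_set_scope.
Local Open Scope ring_scope.

Definition dotv (R : realType) n (u v : 'cV[R]_n) : R :=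
  \sum_(i < n) u i 0 * v i 0.

(* The Euclidean norm is scaled: ||u||^2 = (1/n) \sum_i u_i^2. *)
Definition sqnorm (R : realType) n (u : 'cV[R]_n) : R :=
  n%:R^-1 * \sum_(i < n) u i 0 ^+ 2.

(* Coordinates are numbered 0, ..., n-1, so the interior indices
   {2, ..., n-1} of the usual 1-based numbering become {1, ..., n-2}. *)
Definition interior_idx n : {set 'I_n} := [set i : 'I_n | (0 < i < n.-1)%N]%SET.

(* On interior indices the cyclic successor and predecessor [ordS], [ord_pred]
   are the genuine i + 1 and i - 1: no wrap-around occurs. *)
Definition affine_at (R : realType) n (u : 'cV[R]_n) (i : 'I_n) : bool :=
  2 * u i 0 == u (ordS i) 0 + u (ord_pred i) 0.

Definition qkinks (R : realType) n (u : 'cV[R]_n) : nat :=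
  #|[set i in interior_idx n | ~~ affine_at u i]%SET|.+1.

Definition HC (R : realType) n : R := \sum_(0 <= i < (n - 2).+1) expR (- i%:R).

Definition nu (R : realType) n (J : {set 'I_n}) : R :=
  expR (- #|J|%:R) / (HC R n * 'C(n - 2, #|J|)%:R).

Definition WJ (R : realType) n (J : {set 'I_n}) : set 'cV[R]_n :=
  [set u | forall i, i \in interior_idx n :\: J -> affine_at u i].

Definition is_orthoproj (R : realType) n (W : set 'cV[R]_n) (Q : 'M[R]_n) :=
  forall v, W (Q *m v) /\ forall w, W w -> dotv (v - Q *m v) w = 0.

(* [get] selects an element of the set; existence and uniqueness of the
   projector are [QJ_orthoproj] and [orthoproj_unique] below. *)
Definition QJ (R : realType) n (J : {set 'I_n}) : 'M[R]_n :=
  get [set Q | is_orthoproj (@WJ R n J) Q].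

(* Weights are functions on all sets of indices, but only their values at
   subsets of the interior indices are ever used. *)
Definition mu_theta (R : realType) n (y : 'cV[R]_n) (theta : {set 'I_n} -> R) :
  'cV[R]_n :=
  \sum_(J : {set 'I_n} | J \subset interior_idx n) theta J *: (QJ R J *m y).

Definition simplex (R : realType) n : set ({set 'I_n} -> R) :=
  [set theta | (forall J : {set 'I_n}, J \subset interior_idx n -> 0 <= theta J) /\
     \sum_(J : {set 'I_n} | J \subset interior_idx n) theta J = 1].

Definition Qobjective (R : realType) n (sigma : R) (y : 'cV[R]_n)
    (theta : {set 'I_n} -> R) : R :=
  sqnorm (mu_theta y theta - y) +
  \sum_(J : {set 'I_n} | J \subset interior_idx n)
    theta J * (2 * sigma ^+ 2 * #|J|%:R / n%:R +
               2^-1 * sqnorm (mu_theta y theta - QJ R J *m y) +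
               46 * sigma ^+ 2 / n%:R * ln (1 / nu R J)).

Definition is_Qconv_estimator (R : realType) n (sigma : R)
    (muhat : 'cV[R]_n -> 'cV[R]_n) : Prop :=
  forall y : 'cV[R]_n, exists theta : {set 'I_n} -> R,
    [/\ simplex theta,
        forall theta', simplex theta' ->
          Qobjective sigma y theta <= Qobjective sigma y theta' &
        muhat y = mu_theta y theta].

(* The law of xi is N(0, sigma^2 I), i.e. the n-fold product of the
   one-dimensional N(0, sigma^2); a product law is determined by its values on
   measurable boxes.  The second parameter of [normal_prob] is the standard
   deviation. *)
Definition gaussian_noise (R : realType) n (sigma : R) d
    (Omega : measurableType d) (P : probability Omega R)
    (xi : 'I_n -> {RV P >-> R}) : Prop :=
  forall A : 'I_n -> set R, (forall i, measurable (A i)) ->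
    P [set w | forall i, A i (xi i w)] =
      (\prod_(i < n) normal_prob 0 sigma (A i))%E.

Definition observation (R : realType) n (mu : 'cV[R]_n) d
    (Omega : measurableType d) (P : probability Omega R)
    (xi : 'I_n -> {RV P >-> R}) (w : Omega) : 'cV[R]_n :=
  mu + \col_(i < n) xi i w.

Definition oracle (R : realType) n (c sigma : R) (mu u : 'cV[R]_n) : R :=
  sqnorm (mu - u) +
  c * sigma ^+ 2 * (qkinks u)%:R / n%:R * ln (expR 1 * n%:R / (qkinks u)%:R).

Definition is_minimum (R : realType) (T : Type) (f : T -> R) (m : R) : Prop :=
  (exists u, f u = m) /\ forall u, m <= f u.

Lemma dotvE (R : realType) n (u v : 'cV[R]_n) : dotv u v = (u^T *m v) 0 0.
Proof. by rewrite mxE; apply: eq_bigr => i _; rewrite mxE. Qed.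

Lemma dotv_eq0 (R : realType) n (u : 'cV[R]_n) : dotv u u = 0 -> u = 0.
Proof.
move=> u0; apply/colP => i; rewrite mxE; apply/eqP.
have := u0; rewrite /dotv => /psumr_eq0P H.
have /eqP := H (fun j _ => sqr_ge0 (u j 0)) i isT.
by rewrite mulf_eq0 orbb.
Qed.

Lemma orthoproj_unique (R : realType) n (W : set 'cV[R]_n) (Q Q' : 'M[R]_n) :
  (forall v w, W v -> W w -> W (v - w)) ->
  is_orthoproj W Q -> is_orthoproj W Q' -> Q = Q'.
Proof.
move=> WB hQ hQ'.
have dotB (a b c : 'cV[R]_n) : dotv (a - b) c = dotv a c - dotv b c.
  by rewrite !dotvE linearB /= mulmxBl !mxE.
have QQ' (v : 'cV[R]_n) : Q *m v = Q' *m v.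
  have [Wv ov] := hQ v; have [Wv' ov'] := hQ' v.
  apply/eqP; rewrite -subr_eq0; apply/eqP; apply: dotv_eq0.
  have WD := WB _ _ Wv Wv'.
  rewrite -[X in dotv X _](_ : (v - Q' *m v) - (v - Q *m v) = _).
    by rewrite dotB ov // ov' // subrr.
  by rewrite opprB addrC addrA subrK.
apply/matrixP => i j; have := congr1 (fun M : 'cV[R]_n => M i 0) (QQ' (delta_mx j 0)).
by rewrite -!colE !mxE.
Qed.

Lemma orthoproj_ker (R : realType) n m (A : 'M[R]_(m, n)) :
  exists Q, is_orthoproj [set u : 'cV[R]_n | A *m u = 0] Q.
Proof.
have [r [B [Bfree BE]]] : exists r (B : 'M[R]_(r, n)),
    row_free B /\ (B :=: kermx A^T)%MS.
  by exists _, (row_base (kermx A^T)); split; [exact: row_base_free|exact: eq_row_base].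
have AB : B *m A^T = 0.
  by apply/sub_kermxP; rewrite BE.
pose G := B *m B^T.
have Gu : G \in unitmx.
  rewrite -row_free_unit -kermx_eq0; apply/eqP/row_matrixP => i.
  rewrite row0; set x := row i _.
  have xG : x *m G = 0 by rewrite -row_mul mulmx_ker row0.
  have : (x *m B)^T = 0.
    by apply: dotv_eq0; rewrite dotvE trmxK trmx_mul mulmxA -(mulmxA x) -/G xG mul0mx mxE.
  move/(congr1 trmx); rewrite trmxK trmx0 => xB.
  by apply: (row_free_inj Bfree); rewrite mul0mx.
exists (B^T *m invmx G *m B) => v; split => /=.
  have -> : A *m (B^T *m invmx G *m B *m v) = (B *m A^T)^T *m (invmx G *m B *m v).
    by rewrite trmx_mul trmxK !mulmxA.
  by rewrite AB trmx0 mul0mx.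
move=> w Aw.
have /submxP[x xE] : (w^T <= B)%MS.
  by rewrite BE; apply/sub_kermxP; rewrite -trmx_mul Aw trmx0.
have -> : w = B^T *m x^T by rewrite -trmx_mul -xE trmxK.
rewrite dotvE linearB /= !trmx_mul trmxK trmx_inv mulmxBl.
have -> : G^T = G by rewrite trmx_mul trmxK.
rewrite !mulmxA.
have -> : v^T *m B^T *m invmx G *m B *m B^T *m x^T =
          v^T *m B^T *m (invmx G *m G) *m x^T by rewrite !mulmxA.
by rewrite mulVmx // mulmx1 subrr mxE.
Qed.

Lemma WJB (R : realType) n (J : {set 'I_n}) (v w : 'cV[R]_n) :
  WJ J v -> WJ J w -> WJ J (v - w).
Proof.
move=> hv hw i hi; move: (hv i hi) (hw i hi) => /eqP ev /eqP ew.
by rewrite /affine_at !mxE mulrBr ev ew opprD addrACA.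
Qed.

Lemma QJ_orthoproj (R : realType) n (J : {set 'I_n}) :
  is_orthoproj (@WJ R n J) (QJ R J).
Proof.
pose A : 'M[R]_n := \matrix_(i, j)
  if i \in interior_idx n :\: J
  then 2 * (j == i)%:R - (j == ordS i)%:R - (j == ord_pred i)%:R else 0.
have deltaE (u : 'cV[R]_n) k : \sum_j (j == k)%:R * u j 0 = u k 0.
  rewrite (bigD1 k) //= eqxx mul1r big1 ?addr0 // => j /negbTE ->.
  by rewrite mul0r.
have AE (u : 'cV[R]_n) i : (A *m u) i 0 = if i \in interior_idx n :\: J
    then 2 * u i 0 - u (ordS i) 0 - u (ord_pred i) 0 else 0.
  rewrite mxE; case: ifP => hi; last first.
    by rewrite big1 // => j _; rewrite mxE hi mul0r.
  rewrite -(deltaE u i) -(deltaE u (ordS i)) -(deltaE u (ord_pred i)).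
  rewrite mulr_sumr -!sumrB; apply: eq_bigr => j _.
  by rewrite mxE hi !mulrBl mulrA.
rewrite /QJ; have -> : @WJ R n J = [set u | A *m u = 0].
  apply/seteqP; split => u /= hu.
    apply/colP => i; rewrite AE mxE; case: ifP => // hi.
    by have /eqP -> := hu i hi; rewrite -addrA -opprD subrr.
  move=> i hi; have := congr1 (fun M : 'cV[R]_n => M i 0) hu.
  by rewrite /affine_at AE hi mxE -addrA -opprD => /eqP; rewrite subr_eq0.
by have [Q hQ] := orthoproj_ker A; apply: (@getPex _ (is_orthoproj _)); exists Q.
Qed.

(* Main.v *)
Require Import Defs.
From mathcomp Require Import all_boot all_order all_algebra.
From mathcomp Require Import all_classical all_reals all_analysis.
From mathcomp Require Import measurable_realfun zify ring lra.

(** The estimator is compared with the projector onto [WJ (kinks u)] for a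
minimizer [u] of the oracle functional.  Three ideas carry the proof.

Strong convexity.  On the simplex the objective equals
[1/2 * sqnorm (mu_theta y theta)] plus an affine function of [theta], so at a
minimizer it grows at least like half the squared distance between aggregates
([Qobj_strong_convexity]).  Compared with the vertex [J0 := kinks u], this
bounds the loss of the estimator by that of [QJ R J0 *m y], plus the penalty of
[J0], plus a weighted mean over [J] of
[2 * sdot xi v - 1/2 * sqnorm v - penalty of J], where
[v := QJ R J *m y - QJ R J0 *m y] ([Qaggregation_oracle]).  Since [WJ] is
monotone, [v] lies in [WJ (J :|: J0)], a space of dimension at most
[#|J| + #|J0| + 2] ([WJ_basis]).  Completing the square in an orthonormal basis
of it bounds the first two terms by twice the squared norm of the projected
noise ([linearize_by_basis]).  The constant [46] of the penalty leaves enough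
room for so crude an estimate.

One exponential moment.  For orthonormal vectors the exponential of
[9 / 50 / sigma ^+ 2] times the squared norm of the projected noise has
expectation [(5 / 4) ^+ dimension] ([mgf_sumsq_noise]).  Summing over all [J]
with the penalty in the exponent, and using that the prior [nu] has total mass
one, gives a single random variable of expectation at most
[(5 / 4) ^+ (#|J0| + 2)] whose logarithm dominates all the noise terms at once
([integral_exp_excess_sum_le]).  Thus the loss is at most the oracle bound plus
[sigma ^+ 2 / n] times a multiple of [ln Y] with [Y] of mean at most one
([Qconv_risk_bound]): Markov's inequality gives the deviation bound,
[ln Y <= Y - 1] the bound in expectation.

Regularity.  The event in the theorem has to be measurable although the weights
are an arbitrary choice of minimizers.  The aggregate does not depend on that
choice, and strong convexity makes it a continuous function of the data
([Qaggregation_stability], [loss_measurable]).  The minimum of the oracle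
functional is attained because only the finitely many vectors [QJ R J *m mu]
compete ([oracle_minimum]). *)

Import Order.TTheory GRing.Theory Num.Theory.
Import numFieldNormedType.Exports.

Set Implicit Arguments.
Unset Strict Implicit.
Unset Printing Implicit Defensive.

Local Open Scope classical_set_scope.
Local Open Scope ring_scope.

(** * Integration against transferred and Gaussian measures *)

(** If the measure with density [g] with respect to [P] has image [Q] under
[phi], then integrals against [Q] are integrals against [P] weighted by [g].
With [phi] the identity this is integration against a density; with [phi] a
coordinate of the noise and [g] a product of functions of the other coordinates
it is one step of the factorization of expectations.  The identity extends from
indicators to simple functions by linearity, and then by monotone
convergence. *)
Section weighted_transfer.
Context (R : realType) (d1 d2 : measure_display).
Context (X : measurableType d1) (Y : measurableType d2).
Variables (P : {measure set X -> \bar R}) (Q : {measure set Y -> \bar R}).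
Variables (phi : X -> Y) (g : X -> R).
Hypotheses (mphi : measurable_fun setT phi) (mg : measurable_fun setT g).
Hypothesis g0 : forall x, 0 <= g x.
Hypothesis PQ : forall A, measurable A ->
  (\int[P]_x (\1_A (phi x) * g x)%:E = Q A)%E.

Import HBNNSimple.

Let transfer_nnsfun (h : {nnsfun Y >-> R}) :
  (\int[P]_x (h (phi x) * g x)%:E = \int[Q]_y (h y)%:E)%E.
Proof.
transitivity (\int[Q]_y
   (\sum_(r \in range h) (r * \1_(h @^-1` [set r]) y)%:E))%E; last first.
  by apply: eq_integral => y _; rewrite /= [in RHS](fimfunE h) -fsumEFin.
rewrite ge0_integral_fsum//; last 2 first.
- by move=> r; apply/measurable_EFinP/measurable_funM.
- by move=> r y _; exact: nnfun_muleindic_ge0.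
transitivity (\int[P]_x (\sum_(r \in range h)
    (r%:E * (\1_(h @^-1` [set r]) (phi x) * g x)%:E)))%E.
  apply: eq_integral => x _; rewrite (fimfunE h) EFinM -fsumEFin//.
  rewrite ge0_mule_fsuml; last by move=> r; exact: nnfun_muleindic_ge0.
  by apply: eq_fsbigr => r _; rewrite -!EFinM mulrA.
rewrite ge0_integral_fsum//; last 2 first.
- move=> r; apply/measurable_EFinP/measurable_funM => //.
  apply/measurable_funM => //.
  apply: (measurableT_comp _ mphi) => //; exact: measurable_indic.
- by move=> r x _; rewrite -EFinM mulrA lee_fin mulr_ge0// -lee_fin EFinM nnfun_muleindic_ge0.
apply: eq_fsbigr => r; rewrite inE => -[y _ <-].
rewrite ge0_integralZl//; last 3 first.
- apply/measurable_EFinP/measurable_funM => //.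
  apply: (measurableT_comp _ mphi) => //; exact: measurable_indic.
- by move=> x _; rewrite lee_fin mulr_ge0.
- by rewrite lee_fin.
by rewrite PQ// integralZl_indic_nnsfun// integral_indic// setIT.
Qed.

Lemma integral_transfer (f : Y -> R) : measurable_fun setT f ->
  (forall y, 0 <= f y) ->
  (\int[P]_x (f (phi x) * g x)%:E = \int[Q]_y (f y)%:E)%E.
Proof.
move=> mf f0.
have mF : measurable_fun setT (EFin \o f) by exact/measurable_EFinP.
pose h := nnsfun_approx measurableT mF.
have hf y : (h n y)%:E @[n --> \oo] --> (f y)%:E.
  by apply: (cvg_nnsfun_approx measurableT mF) => // z _; rewrite lee_fin.
have ndh y : {homo (fun n => h n y) : a b / (a <= b)%N >-> a <= b}.
  by move=> a b ab; exact/lefP/nd_nnsfun_approx.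
transitivity (limn (fun n => \int[Q]_y (h n y)%:E))%E; last first.
  rewrite -monotone_convergence//.
  - by apply: eq_integral => y _; apply/cvg_lim.
  - by move=> n; exact/measurable_EFinP.
  - by move=> n y _; rewrite lee_fin.
  - by move=> y _ a b ab; rewrite lee_fin ndh.
under [in RHS]eq_fun do rewrite -transfer_nnsfun.
rewrite -monotone_convergence//.
- apply: eq_integral => x _; apply/esym/cvg_lim => //.
  under eq_fun do rewrite EFinM; rewrite EFinM.
  by apply: cvgeZr => //; exact: hf.
- move=> n; apply/measurable_EFinP/measurable_funM => //.
  by apply: measurableT_comp.
- by move=> n x _; rewrite lee_fin mulr_ge0.
- by move=> x _ a b ab; rewrite lee_fin ler_wpM2r// ndh.
Qed.

End weighted_transfer.

Lemma integral_normal_prob (R : realType) (m s : R) (f : R -> R) :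
  measurable_fun setT f -> (forall x, 0 <= f x) ->
  (\int[normal_prob m s]_x (f x)%:E =
   \int[lebesgue_measure]_x (f x * normal_pdf m s x)%:E)%E.
Proof.
move=> mf f0; apply/esym.
apply: (@integral_transfer R _ _ _ _ lebesgue_measure (normal_prob m s) id) => //.
- exact: measurable_normal_pdf.
- exact: normal_pdf_ge0.
- move=> A mA; rewrite /normal_prob [RHS]integral_mkcond.
  apply: eq_integral => x _; rewrite patchE indicE.
  by case: ifPn => xA; rewrite ?mul1r ?mul0r.
Qed.

(** Completing the square: tilting [normal_pdf 0 s] by [expR (t * x)] moves its
mean to [s ^+ 2 * t]. *)
Lemma integral_normal_expR (R : realType) (s t : R) : s != 0 ->
  (\int[normal_prob 0 s]_x (expR (t * x))%:E =
   (expR (s ^+ 2 * t ^+ 2 / 2))%:E)%E.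
Proof.
move=> s0; rewrite integral_normal_prob//; last first.
  by apply: measurableT_comp => //; exact: measurable_funM.
under eq_integral => x _.
  have -> : expR (t * x) * normal_pdf 0 s x =
      expR (s ^+ 2 * t ^+ 2 / 2) * normal_pdf (s ^+ 2 * t) s x.
    rewrite !normal_pdfE// mulrCA [RHS]mulrCA; congr (_ * _).
    rewrite /normal_fun -!expRD; congr expR; rewrite -mulr_natr.
    by field; rewrite s0.
  rewrite EFinM; over.
rewrite ge0_integralZl//.
- by rewrite integral_normal_pdf mule1.
- by apply/measurable_EFinP; exact: measurable_normal_pdf.
- by move=> x _; rewrite lee_fin normal_pdf_ge0.
Qed.

(** The tilted density is again Gaussian, with variance
[1 / (1 - 9 / 25) = (5 / 4) ^+ 2].  The coefficient [9 / 50] is chosen so that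
this variance is the square of a rational number. *)
Lemma integral_normal_expR_sqr (R : realType) :
  (\int[normal_prob 0 1]_x (expR (9 / 50 * x ^+ 2))%:E = (5 / 4 : R)%:E)%E.
Proof.
rewrite integral_normal_prob//; last first.
  by apply: measurableT_comp => //; apply: measurable_funM => //; exact: measurable_funX.
under eq_integral => x _.
  have -> : expR (9 / 50 * x ^+ 2) * normal_pdf 0 1 x =
      (5 / 4) * normal_pdf 0 (5 / 4) x.
    have n0 : (5 / 4 : R) != 0 by apply: lt0r_neq0; lra.
    rewrite (normal_pdfE _ n0) (normal_pdfE _ (oner_neq0 R)).
    rewrite mulrCA [RHS]mulrA; congr (_ * _).
      rewrite /normal_peak -[(5 / 4) ^+ 2 * _ *+ 2]mulrnAr expr1n mul1r.
      rewrite sqrtrM ?sqr_ge0// sqrtr_sqr ger0_norm; last lra.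
      by rewrite [in RHS]invfM mulrA divff ?mul1r.
    by rewrite /normal_fun -!expRD; congr expR; field.
  rewrite EFinM; over.
rewrite ge0_integralZl//.
- by rewrite integral_normal_pdf mule1.
- by apply/measurable_EFinP; exact: measurable_normal_pdf.
- by move=> x _; rewrite lee_fin normal_pdf_ge0.
Qed.

(** * Independence of the coordinates of the noise *)

Section gaussian_vector.
Context (R : realType) (n : nat) (sigma : R).
Context (d : measure_display) (Omega : measurableType d).
Context (P : probability Omega R) (xi : 'I_n -> {RV P >-> R}).
Hypothesis sigma0 : 0 < sigma.
Hypothesis xiN : gaussian_noise sigma xi.

(** [gaussian_noise] states the product rule for indicator functions only.  The
indicators are replaced by the functions [f i] one coordinate at a time: with
the other factors fixed, both sides are integrals of the remaining factor
against measures that agree on measurable sets. *)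
Lemma integral_prod_noise (f : 'I_n -> R -> R) (c : 'I_n -> R) :
  (forall i, measurable_fun setT (f i)) -> (forall i x, 0 <= f i x) ->
  (forall i, \int[normal_prob 0 sigma]_x (f i x)%:E = (c i)%:E)%E ->
  (\int[P]_w (\prod_i f i (xi i w))%:E = (\prod_i c i)%:E)%E.
Proof.
(* The factors of index at least [k] are still indicator functions. *)
suff claim k : forall (f : 'I_n -> R -> R) (c : 'I_n -> R),
    (forall i : 'I_n, (k <= i)%N -> exists2 A, measurable A & f i = \1_A) ->
    (forall i, measurable_fun setT (f i)) -> (forall i x, 0 <= f i x) ->
    (forall i, \int[normal_prob 0 sigma]_x (f i x)%:E = (c i)%:E)%E ->
    (\int[P]_w (\prod_i f i (xi i w))%:E = (\prod_i c i)%:E)%E.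
  apply: (claim n) => i; by rewrite leqNgt ltn_ord.
elim: k => [|k IH] {}f {}c fA mf f0 fc.
  have [A AP] : {A : 'I_n -> set R & forall i, measurable (A i) /\ f i = \1_(A i)}.
    apply: (@choice _ _ (fun i B => measurable B /\ f i = \1_B)) => i.
    by have [B mB fB] := fA i isT; exists B.
  have mA i := (AP i).1.
  have cE i : (normal_prob 0 sigma (A i) = (c i)%:E)%E.
    rewrite -fc (AP i).2 integral_indic//; last exact: (AP i).1.
    by rewrite setIT.
  rewrite -prodEFin; under [in RHS]eq_bigr do rewrite -cE.
  rewrite -xiN//.
  have mS : measurable [set w | forall i, A i (xi i w)].
    rewrite (_ : [set w | _] = \bigcap_(i in [set: 'I_n]) (xi i @^-1` (A i))); last first.
      by apply/seteqP; split => w /= H i; [move=> _|]; exact: H.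
    apply: fin_bigcap_measurable => // i _.
    by rewrite -[X in measurable X]setTI; exact: measurable_funP.
  rewrite -[in RHS](setIT [set w | _]) -integral_indic//.
  apply: eq_integral => w _; congr EFin.
  under eq_bigr do rewrite (AP _).2.
  rewrite indicE; case: (boolP (w \in _)) => [/set_mem /= wA|wA].
    by rewrite big1// => i _; rewrite indicE mem_set.
  have /existsNP[i Ai] : ~ forall i, A i (xi i w) by move=> H; move/negP: wA; apply; exact: mem_set.
  by rewrite (bigD1 i)//= indicE memNset// mul0r.
have [nk|kn] := leqP n k.
  by apply: IH => // i; rewrite leqNgt (leq_trans (ltn_ord i) nk).
pose i0 := Ordinal kn.
have c0 i : 0 <= c i.
  by rewrite -lee_fin -fc; apply: integral_ge0 => x _; rewrite lee_fin.
pose C := \prod_(i | i != i0) c i.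
have C0 : 0 <= C by apply: prodr_ge0.
pose g w := \prod_(i | i != i0) f i (xi i w).
transitivity (\int[P]_w (f i0 (xi i0 w) * g w)%:E)%E.
  by apply: eq_integral => w _; rewrite (bigD1 i0).
have mg : measurable_fun setT g.
  rewrite (_ : g = fun w =>
      \prod_(i <- [seq i <- index_enum 'I_n | i != i0]) f i (xi i w)); last first.
    by apply/funext => w; rewrite big_filter.
  by apply: measurable_prod => i _; exact: measurableT_comp.
have g0 w : 0 <= g w by apply: prodr_ge0.
pose N' : {measure set (measurableTypeR R) -> \bar R} :=
   mscale (NngNum C0) (normal_prob 0 sigma).
have mEf : measurable_fun setT (EFin \o f i0) by exact/measurable_EFinP.
suff PQ (A : set (measurableTypeR R)) : measurable A -> (\int[P]_w (\1_A (xi i0 w) * g w)%:E = N' A)%E.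
  rewrite (@integral_transfer _ _ _ _ (measurableTypeR R) _ N' _ _ (measurable_funP (xi i0)) mg g0 PQ _ (mf i0) (f0 i0)).
  rewrite ge0_integral_mscale//; last by move=> x _; rewrite lee_fin.
  by rewrite fc -EFinM [in RHS](bigD1 i0)//= mulrC.
move=> mA.
have NA : normal_prob 0 sigma A \is a fin_num by exact: fin_num_measure.
have := IH (fun i => if i == i0 then \1_A else f i)
           (fun i => if i == i0 then fine (normal_prob 0 sigma A) else c i).
rewrite (bigD1 i0)//= eqxx.
under eq_bigr => i /negbTE -> do over.
rewrite -/C EFinM fineK// /mscale/= muleC => <-.
- apply: eq_integral => w _; rewrite [in RHS](bigD1 i0)//= eqxx.
  congr (_ * _)%:E; rewrite /g.
  by under [in RHS]eq_bigr => i /negbTE -> do over.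
- move=> i ki; case: eqVneq => [_|ne]; first by exists A.
  apply: fA; rewrite ltn_neqAle ki andbT; apply: contra ne => /eqP e.
  by apply/eqP/val_inj.
- move=> i; case: ifP => // _; exact: measurable_indic.
- by move=> i x; case: ifP.
- move=> i; case: ifP => // _.
  by rewrite integral_indic// setIT fineK.
Qed.

Definition noise w : 'cV[R]_n := \col_i xi i w.

Lemma measurable_dotv_noise (a : 'cV[R]_n) :
  measurable_fun setT (fun w => dotv a (noise w)).
Proof.
rewrite (_ : (fun _ => _) = fun w => \sum_i a i 0 * xi i w); last first.
  by apply/funext => w; apply: eq_bigr => i _; rewrite mxE.
by apply: measurable_sum => i; exact: measurable_funM.
Qed.

Lemma mgf_dotv_noise (a : 'cV[R]_n) :
  (\int[P]_w (expR (dotv a (noise w)))%:E =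
   (expR (sigma ^+ 2 / 2 * dotv a a))%:E)%E.
Proof.
transitivity (\int[P]_w (\prod_i expR (a i 0 * xi i w))%:E)%E.
  apply: eq_integral => w _; rewrite -expR_sum; congr (expR _)%:E.
  by apply: eq_bigr => i _; rewrite mxE.
rewrite (integral_prod_noise (f := fun i x => expR (a i 0 * x))
   (c := fun i => expR (sigma ^+ 2 * a i 0 ^+ 2 / 2)))//.
- rewrite -expR_sum mulr_sumr; congr (expR _)%:E; apply: eq_bigr => i _.
  by rewrite expr2; ring.
- by move=> i; apply: measurableT_comp => //; exact: measurable_funM.
- by move=> i; rewrite integral_normal_expR// gt_eqF.
Qed.

End gaussian_vector.

(** * The exponential moment of the projected noise *)

Section dot_product.
Context (R : realType) (n : nat).
Implicit Types u v w : 'cV[R]_n.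

Lemma dotvC u v : dotv u v = dotv v u.
Proof. by apply: eq_bigr => i _; rewrite mulrC. Qed.

Lemma dotvDl u v w : dotv (u + v) w = dotv u w + dotv v w.
Proof. by rewrite -big_split; apply: eq_bigr => i _; rewrite mxE mulrDl. Qed.

Lemma dotvZl a u v : dotv (a *: u) v = a * dotv u v.
Proof. by rewrite mulr_sumr; apply: eq_bigr => i _; rewrite mxE mulrA. Qed.

Lemma dotvDr u v w : dotv u (v + w) = dotv u v + dotv u w.
Proof. by rewrite dotvC dotvDl !(dotvC u). Qed.

Lemma dotvZr a u v : dotv u (a *: v) = a * dotv u v.
Proof. by rewrite dotvC dotvZl dotvC. Qed.

Lemma dotvNl u v : dotv (- u) v = - dotv u v.
Proof. by rewrite -scaleN1r dotvZl mulN1r. Qed.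

Lemma dotvNr u v : dotv u (- v) = - dotv u v.
Proof. by rewrite dotvC dotvNl dotvC. Qed.

Lemma dotv0r u : dotv u 0 = 0.
Proof. by rewrite -(scale0r u) dotvZr mul0r. Qed.

Lemma dotv_sumr u (I : Type) (r : seq I) (p : pred I) (f : I -> 'cV[R]_n) :
  dotv u (\sum_(i <- r | p i) f i) = \sum_(i <- r | p i) dotv u (f i).
Proof. by apply: (big_morph (dotv u) (dotvDr u) (dotv0r u)). Qed.

Lemma dotv_suml u (I : Type) (r : seq I) (p : pred I) (f : I -> 'cV[R]_n) :
  dotv (\sum_(i <- r | p i) f i) u = \sum_(i <- r | p i) dotv (f i) u.
Proof. by rewrite dotvC dotv_sumr; apply: eq_bigr => i _; rewrite dotvC. Qed.

Lemma dotv_ge0 u : 0 <= dotv u u.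
Proof. by apply: sumr_ge0 => i _; rewrite -expr2 sqr_ge0. Qed.

(** Each vector is compared with the later ones only, which is the form in which
inductions on the family use orthogonality. *)
Fixpoint orthonormal (es : seq 'cV[R]_n) : Prop :=
  if es is e :: es' then
    [/\ dotv e e = 1, forall e', e' \in es' -> dotv e e' = 0 & orthonormal es']
  else True.

(** For an orthonormal family this is the squared norm of the projection of [v]
onto its span. *)
Definition sumsq (es : seq 'cV[R]_n) v := \sum_(e <- es) dotv e v ^+ 2.

End dot_product.

Section chi_square.
Context (R : realType) (n : nat) (sigma : R).
Context (d : measure_display) (Omega : measurableType d).
Context (P : probability Omega R) (xi : 'I_n -> {RV P >-> R}).
Hypothesis sigma0 : 0 < sigma.
Hypothesis xiN : gaussian_noise sigma xi.

Lemma measurable_sumsq_noise es : measurable_fun setT (fun w => sumsq es (noise xi w)).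
Proof.
apply: measurable_sum => e; apply: measurable_funX => //.
exact: measurable_dotv_noise.
Qed.

(** By induction on the family.  The factor [expR (lambda * dotv e x ^+ 2)] is the
expectation over an independent standard normal [g] of the exponential of a
linear form, [expR (3 / 5 / sigma * g * dotv e x)].  Exchanging the integrals, that
linear form joins [a]; this is why the statement carries a vector [a]
orthogonal to the family. *)
Lemma mgf_sumsq_noise es (a : 'cV[R]_n) :
  orthonormal es -> (forall e, e \in es -> dotv e a = 0) ->
  (\int[P]_w (expR (dotv a (noise xi w) +
                    9 / 50 / sigma ^+ 2 * sumsq es (noise xi w)))%:E =
   ((5 / 4) ^+ size es * expR (sigma ^+ 2 / 2 * dotv a a))%:E)%E.
Proof.
have s0 : sigma != 0 by rewrite gt_eqF.
elim: es a => [a _ _|e es IH a /= [e1 ees oes] ea].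
  under eq_integral do rewrite /sumsq big_nil mulr0 addr0.
  by rewrite (mgf_dotv_noise sigma0 xiN) expr0 mul1r.
pose b (g : R) := a + (3 / 5 / sigma * g) *: e.
pose F (z : Omega * R) : \bar R :=
  (expR (dotv a (noise xi z.1) + 9 / 50 / sigma ^+ 2 * sumsq es (noise xi z.1)
    + 3 / 5 / sigma * dotv e (noise xi z.1) * z.2))%:E.
have mF : measurable_fun setT F.
  have m1 (f : Omega -> R) : measurable_fun setT f ->
      measurable_fun setT (fun z : Omega * R => f z.1).
    by move=> mf; exact: (measurableT_comp mf measurable_fst).
  apply/measurable_EFinP; apply: measurableT_comp => //.
  apply: measurable_funD; first apply: measurable_funD.
  - exact: (m1 _ (measurable_dotv_noise _ _)).
  - by apply: measurable_funM => //; exact: (m1 _ (measurable_sumsq_noise es)).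
  apply: measurable_funM => //.
  by apply: measurable_funM => //; exact: (m1 _ (measurable_dotv_noise _ _)).
have F0 z : (0 <= F z)%E by rewrite lee_fin.
(* Integrating [g] out of [F] restores the quadratic factor of [e]. *)
transitivity (\int[P]_w \int[normal_prob 0 1]_g F (w, g))%E.
  apply: eq_integral => w _; rewrite /F/=.
  under [RHS]eq_integral do rewrite expRD EFinM.
  have mE : measurable_fun setT (fun g : R =>
      (expR (3 / 5 / sigma * dotv e (noise xi w) * g))%:E).
    by apply/measurable_EFinP; apply: measurableT_comp.
  rewrite ge0_integralZl//.
  rewrite integral_normal_expR// -EFinM -expRD; congr (expR _)%:E.
  by rewrite /sumsq big_cons; field.
rewrite (@fubini_tonelli _ _ _ _ _ P (normal_prob 0 1) F mF F0).
transitivity (\int[normal_prob 0 1]_g (((5 / 4) ^+ size es *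
    expR (sigma ^+ 2 / 2 * dotv a a))%:E * (expR (9 / 50 * g ^+ 2))%:E))%E.
  apply: eq_integral => g _; rewrite -EFinM -[X in X%:E]mulrA -expRD.
  have ae : dotv a e = 0 by rewrite dotvC ea// mem_head.
  have -> : sigma ^+ 2 / 2 * dotv a a + 9 / 50 * g ^+ 2 =
      sigma ^+ 2 / 2 * dotv (b g) (b g).
    rewrite /b !(dotvDl, dotvDr, dotvZl, dotvZr) (dotvC e) ae e1.
    by field.
  rewrite -IH//; last first.
    move=> e' e'es; rewrite dotvDr dotvZr ea ?inE ?e'es ?orbT// add0r.
    by rewrite dotvC ees// mulr0.
  apply: eq_integral => w _; rewrite /F /b/=; congr (expR _)%:E.
  by rewrite dotvDl dotvZl; ring.
rewrite ge0_integralZl//.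
- by rewrite integral_normal_expR_sqr -EFinM (exprS (5 / 4)); congr EFin; ring.
- apply/measurable_EFinP; apply: measurableT_comp => //.
  by apply: measurable_funM => //; exact: measurable_funX.
Qed.

End chi_square.

(** * Convexity of the Q-aggregation objective *)

Section scaled_inner_product.
Context (R : realType) (n : nat).
Implicit Types u v w : 'cV[R]_n.

Definition sdot u v : R := n%:R^-1 * dotv u v.

Lemma sqnormE u : sqnorm u = sdot u u.
Proof. by congr (_ * _); apply: eq_bigr => i _; rewrite expr2. Qed.

Lemma sdotC u v : sdot u v = sdot v u.
Proof. by rewrite /sdot dotvC. Qed.

Lemma sdotDl u v w : sdot (u + v) w = sdot u w + sdot v w.
Proof. by rewrite /sdot dotvDl mulrDr. Qed.

Lemma sdotDr u v w : sdot u (v + w) = sdot u v + sdot u w.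
Proof. by rewrite /sdot dotvDr mulrDr. Qed.

Lemma sdotZl a u v : sdot (a *: u) v = a * sdot u v.
Proof. by rewrite /sdot dotvZl mulrCA. Qed.

Lemma sdotZr a u v : sdot u (a *: v) = a * sdot u v.
Proof. by rewrite /sdot dotvZr mulrCA. Qed.

Lemma sdotNl u v : sdot (- u) v = - sdot u v.
Proof. by rewrite /sdot dotvNl mulrN. Qed.

Lemma sdotNr u v : sdot u (- v) = - sdot u v.
Proof. by rewrite /sdot dotvNr mulrN. Qed.

Definition sdotE := (sdotDl, sdotDr, sdotZl, sdotZr, sdotNl, sdotNr).

Lemma sdot_suml v (I : Type) (r : seq I) (p : pred I) (f : I -> 'cV[R]_n) :
  sdot (\sum_(i <- r | p i) f i) v = \sum_(i <- r | p i) sdot (f i) v.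
Proof. by rewrite /sdot dotv_suml mulr_sumr. Qed.

Lemma sqnorm_ge0 u : 0 <= sqnorm u.
Proof. by rewrite sqnormE mulr_ge0 ?invr_ge0 ?ler0n ?dotv_ge0. Qed.

Lemma sqnormD u v : sqnorm (u + v) = sqnorm u + 2 * sdot u v + sqnorm v.
Proof. by rewrite !sqnormE !sdotE (sdotC v u); ring. Qed.

Lemma sqnormB u v : sqnorm (u - v) = sqnorm u - 2 * sdot u v + sqnorm v.
Proof. by rewrite !sqnormE !sdotE (sdotC v u); ring. Qed.

Lemma sqnormZ a u : sqnorm (a *: u) = a ^+ 2 * sqnorm u.
Proof. by rewrite !sqnormE !sdotE; ring. Qed.

Lemma sqnormN u : sqnorm (- u) = sqnorm u.
Proof. by rewrite !sqnormE !sdotE opprK. Qed.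

(** The inequality [2 * sdot u v <= eta * sqnorm u + eta^-1 * sqnorm v] stands in
for Cauchy-Schwarz, which avoids square roots of norms. *)
Lemma sqnormD_le (eta : R) u v : 0 < eta ->
  sqnorm (u + v) <= (1 + eta) * sqnorm u + (1 + eta^-1) * sqnorm v.
Proof.
move=> eta0; have := sqnorm_ge0 (eta *: u - v).
rewrite sqnormB sqnormZ sdotZl sqnormD => H.
rewrite -subr_ge0 -(pmulr_rge0 _ eta0).
rewrite [X in 0 <= X](_ : _ = eta ^+ 2 * sqnorm u - 2 * (eta * sdot u v) + sqnorm v)//.
by field; rewrite gt_eqF.
Qed.

End scaled_inner_product.

(** First order optimality: a function that is minimal at the end [t = 0] of a
segment, and quadratic along it, has nonnegative slope [b] there. *)
Lemma nonneg_of_quadratic (R : realFieldType) (a b : R) :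
  (forall t, 0 < t <= 1 -> 0 <= t * b + t ^+ 2 * a) -> 0 <= b.
Proof.
move=> H; rewrite leNgt; apply/negP => b0.
have a0 : 0 < a by have := H 1; rewrite lexx ltr01 => /(_ isT); lra.
(* As [b] is negative, the quadratic takes a negative value at this [t]. *)
pose t := - b / (a - b).
have ab : 0 < a - b by lra.
have t01 : 0 < t <= 1.
  by rewrite /t divr_gt0 ?ler_pdivrMr; lra.
have := H t t01; have /andP[t0 _] := t01.
rewrite expr2 -mulrA -mulrDr pmulr_rge0//.
have -> : b + t * a = - (b ^+ 2 / (a - b)).
  by rewrite /t; field; rewrite gt_eqF.
rewrite oppr_ge0 leNgt divr_gt0// exprn_even_gt0//=; lra.
Qed.

(** Aggregation of arbitrary vectors [m i] with penalties [pen i]; the projections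
[QJ R J *m y] of the data are the instance of interest. *)
Section Q_aggregation.
Context (R : realType) (n : nat) (I : finType) (D : pred I).
Implicit Types (y mu : 'cV[R]_n) (m : I -> 'cV[R]_n) (pen theta : I -> R).

Definition weights : set (I -> R) :=
  [set theta | (forall i, D i -> 0 <= theta i) /\ \sum_(i | D i) theta i = 1].

Definition aggregate m theta := \sum_(i | D i) theta i *: m i.

Definition Qobj m pen y theta := sqnorm (aggregate m theta - y) +
  \sum_(i | D i) theta i * (pen i + 2^-1 * sqnorm (aggregate m theta - m i)).

Lemma sum_sqnormB m theta a : weights theta ->
  \sum_(i | D i) theta i * sqnorm (m i - a) =
  \sum_(i | D i) theta i * sqnorm (m i) - 2 * sdot (aggregate m theta) a + sqnorm a.
Proof.
move=> [_ th1]; rewrite /aggregate sdot_suml mulr_sumr.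
rewrite -[sqnorm a]mul1r -[X in X * sqnorm a]th1 mulr_suml -sumrB -big_split/=.
by apply: eq_bigr => i _; rewrite sqnormB sdotZl; ring.
Qed.

Lemma sqnorm_aggregate_le m theta : weights theta ->
  sqnorm (aggregate m theta) <= \sum_(i | D i) theta i * sqnorm (m i).
Proof.
move=> th; rewrite -subr_ge0.
have -> : \sum_(i | D i) theta i * sqnorm (m i) - sqnorm (aggregate m theta) =
    \sum_(i | D i) theta i * sqnorm (m i - aggregate m theta).
  by rewrite sum_sqnormB// -sqnormE; ring.
by apply: sumr_ge0 => i Di; rewrite mulr_ge0 ?sqnorm_ge0//; case: th => + _; exact.
Qed.

Let lin m pen y theta := \sum_(i | D i) theta i *
  (pen i + 2^-1 * sqnorm (m i) - 2 * sdot (m i) y).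

Let linE m pen y theta : lin m pen y theta =
  \sum_(i | D i) theta i * pen i +
  2^-1 * (\sum_(i | D i) theta i * sqnorm (m i)) - 2 * sdot (aggregate m theta) y.
Proof.
rewrite /aggregate sdot_suml !mulr_sumr -big_split -sumrB/=.
by apply: eq_bigr => i _; rewrite sdotZl; ring.
Qed.

Let sum_penD pen f theta : \sum_(i | D i) theta i * (pen i + 2^-1 * f i) =
  \sum_(i | D i) theta i * pen i + 2^-1 * (\sum_(i | D i) theta i * f i) :> R.
Proof. by rewrite mulr_sumr -big_split/=; apply: eq_bigr => i _; ring. Qed.

(** The dispersion term [1/2 * sum theta_i sqnorm (aggregate - m i)] removes
half of the square of the aggregate, by [sum_sqnormB]; what is left besides
[1/2 * sqnorm (aggregate m theta)] is affine in [theta]. *)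
Lemma QobjE m pen y theta : weights theta ->
  Qobj m pen y theta =
  2^-1 * sqnorm (aggregate m theta) + lin m pen y theta + sqnorm y.
Proof.
move=> th; rewrite /Qobj sum_penD linE.
under [X in _ + (_ + _ * X) = _]eq_bigr do rewrite -opprB sqnormN.
by rewrite sum_sqnormB// sqnormB -sqnormE; field.
Qed.

(** A form of the objective that involves the data only through the residuals
[m i - y], for comparing objectives with different data. *)
Lemma QobjE_residual m pen y theta : weights theta ->
  Qobj m pen y theta = 2^-1 * sqnorm (aggregate m theta - y) +
    \sum_(i | D i) theta i * (pen i + 2^-1 * sqnorm (m i - y)).
Proof.
by move=> th; rewrite QobjE// linE sum_penD sum_sqnormB// sqnormB; field.
Qed.

(** Along the segment from [theta] to [theta'] the objective is quadratic with
leading coefficient [1/2 * sqnorm] of the difference of aggregates, and its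
slope at the minimizer [theta] is nonnegative. *)
Lemma Qobj_strong_convexity m pen y theta theta' :
  weights theta -> (forall t, weights t -> Qobj m pen y theta <= Qobj m pen y t) ->
  weights theta' ->
  Qobj m pen y theta + 2^-1 * sqnorm (aggregate m theta' - aggregate m theta) <=
  Qobj m pen y theta'.
Proof.
move=> th thmin th'.
pose c := aggregate m theta; pose c' := aggregate m theta'.
pose dl := lin m pen y theta' - lin m pen y theta.
have key : 0 <= sdot c (c' - c) + dl.
  apply: (@nonneg_of_quadratic _ (2^-1 * sqnorm (c' - c))) => t /andP[t0 t1].
  pose tt i := theta i + t * (theta' i - theta i).
  have wt : weights tt.
    split=> [i Di|].
      have -> : tt i = (1 - t) * theta i + t * theta' i by rewrite /tt; ring.
      by rewrite addr_ge0// mulr_ge0 ?th.1 ?th'.1//; lra.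
    by rewrite big_split/= -mulr_sumr sumrB th.2 th'.2 subrr mulr0 addr0.
  have aE : aggregate m tt = c + t *: (c' - c).
    rewrite /aggregate /tt /c /c' -sumrB scaler_sumr -big_split/=.
    by apply: eq_bigr => i _; rewrite scalerDl -scalerBl scalerA.
  have lE : lin m pen y tt = lin m pen y theta + t * dl.
    rewrite /dl /lin -sumrB mulr_sumr -big_split/=.
    by apply: eq_bigr => i _; rewrite /tt; ring.
  have := thmin _ wt; rewrite !QobjE// aE lE sqnormD sqnormZ sdotZr -/c.
  by rewrite -subr_ge0; congr (0 <= _); field.
rewrite !QobjE//.
have -> : sqnorm c' = sqnorm c + 2 * sdot c (c' - c) + sqnorm (c' - c).
  by rewrite -sqnormD subrKC.
by rewrite -/c -/c'; move: key; rewrite /dl; lra.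
Qed.

(** Strong convexity at the vertex [j], with [sqnorm (aggregate m theta - y)]
expanded around [mu].  The distance term [sqnorm (aggregate m theta - m j)] and
the dispersion of the [m i] around the aggregate add up to the mean of
[sqnorm (m i - m j)]. *)
Lemma Qaggregation_oracle m pen y mu theta j :
  weights theta -> (forall t, weights t -> Qobj m pen y theta <= Qobj m pen y t) ->
  D j ->
  sqnorm (aggregate m theta - mu) <= sqnorm (m j - mu) + pen j +
   \sum_(i | D i) theta i * (2 * sdot (y - mu) (m i - m j) -
      2^-1 * sqnorm (m i - m j) - pen i).
Proof.
move=> th thmin Dj.
pose e i : R := (i == j)%:R.
have sum_e (f : I -> R) : \sum_(i | D i) e i * f i = f j.
  rewrite (bigD1 j)//= /e eqxx mul1r big1 ?addr0// => i /andP[_ /negbTE ->].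
  by rewrite mul0r.
have we : weights e.
  split=> [i _|]; first exact: ler0n.
  by rewrite -[RHS](sum_e (fun=> 1)); apply: eq_bigr => i _; rewrite mulr1.
have ae : aggregate m e = m j.
  rewrite /aggregate (bigD1 j)//= /e eqxx scale1r big1 ?addr0// => i /andP[_ /negbTE ->].
  by rewrite scale0r.
have := Qobj_strong_convexity th thmin we.
rewrite !QobjE// ae.
have -> : lin m pen y e = pen j + 2^-1 * sqnorm (m j) - 2 * sdot (m j) y.
  exact: sum_e.
rewrite linE.
have -> : \sum_(i | D i) theta i * (2 * sdot (y - mu) (m i - m j) -
      2^-1 * sqnorm (m i - m j) - pen i) =
    2 * sdot (aggregate m theta - m j) (y - mu) -
    2^-1 * (\sum_(i | D i) theta i * sqnorm (m i - m j)) -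
    \sum_(i | D i) theta i * pen i.
  rewrite sdotDl sdotNl -[sdot (m j) _]mul1r -[X in X * sdot (m j) _]th.2 mulr_suml /aggregate sdot_suml.
  rewrite -sumrB !mulr_sumr -!sumrB.
  by apply: eq_bigr => i _; rewrite sdotC sdotZl sdotDl sdotNl; ring.
rewrite sum_sqnormB// !sqnormB !sdotE.
rewrite (sdotC (aggregate m theta) y) (sdotC (m j) y) (sdotC (m j) (aggregate m theta)).
lra.
Qed.

End Q_aggregation.

(** * Piecewise affine vectors and their projectors *)

Section gram_schmidt.
Context (R : realType) (n : nat).
Implicit Types (u v : 'cV[R]_n) (V : set 'cV[R]_n) (es ls : seq 'cV[R]_n).

(** One vector per functional suffices.  By induction on the functionals: the
basis of the kernel of [l] in [V] is completed by the normalized component,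
orthogonal to that kernel, of a vector on which [l] does not vanish. *)
Lemma gram_schmidt ls V :
  (forall a u v, V u -> V v -> V (a *: u + v)) ->
  (forall u, V u -> (forall l, l \in ls -> dotv l u = 0) -> u = 0) ->
  exists es, [/\ (size es <= size ls)%N, orthonormal es,
    (forall e, e \in es -> V e) &
    forall u, V u -> u = \sum_(e <- es) dotv e u *: e].
Proof.
elim: ls V => [|l ls IH] V Vlin V0.
  by exists [::]; split => // u Vu; rewrite big_nil; exact: V0.
pose V' : set 'cV[R]_n := [set u | V u /\ dotv l u = 0].
have [es [ses oes V'es spanes]] : exists es, [/\ (size es <= size ls)%N,
    orthonormal es, (forall e, e \in es -> V' e) &
    forall u, V' u -> u = \sum_(e <- es) dotv e u *: e].
  apply: IH => [a u v [Vu lu] [Vv lv]|u [Vu lu] lsu].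
    by split; [exact: Vlin|rewrite dotvDr dotvZr lu lv mulr0 addr0].
  by apply: V0 => // l'; rewrite inE => /orP[/eqP ->|/lsu].
have [[v [Vv lv]]|/forallNP nv] := pselect (exists v, V v /\ dotv l v != 0); last first.
  exists es; split => //; first exact: leqW.
    by move=> e /V'es[].
  by move=> u Vu; apply: spanes; split => //; apply/eqP/negPn/negP => lu; apply: (nv u).
(* Since [l] vanishes on [es], subtracting the projection keeps [dotv l w]
   nonzero. *)
pose w := v - \sum_(e <- es) dotv e v *: e.
have [Vw lw] : V w /\ dotv l w != 0.
  split.
    rewrite /w; elim: es V'es {ses oes spanes w} v Vv {lv} => [|e es IHes] V'es v Vv.
      by rewrite big_nil subr0.
    rewrite big_cons opprD addrCA -scaleNr.
    apply: Vlin; first by have [] := V'es e (mem_head _ _).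
    by apply: IHes => // e' e'es; apply: V'es; rewrite inE e'es orbT.
  rewrite dotvDr dotvNr dotv_sumr big_seq big1 ?subr0// => e /V'es[_ le].
  by rewrite dotvZr le mulr0.
have w_perp u : V' u -> dotv w u = 0.
  move=> V'u; rewrite /w dotvDl dotvNl dotv_suml {1}(spanes u V'u) dotv_sumr.
  rewrite -sumrB big1// => e _.
  by rewrite dotvZl dotvZr (dotvC v) mulrC subrr.
have ww0 : 0 < dotv w w.
  rewrite lt_neqAle dotv_ge0 andbT eq_sym; apply: contra lw => /eqP /dotv_eq0 ->.
  by rewrite dotv0r.
pose s := Num.sqrt (dotv w w).
have s0 : s != 0 by rewrite gt_eqF// sqrtr_gt0.
have ss : s ^+ 2 = dotv w w by rewrite sqr_sqrtr// ltW.
exists (s^-1 *: w :: es); split => //=.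
- split => //.
    by rewrite dotvZl dotvZr -ss; field.
  by move=> e /V'es V'e; rewrite dotvZl w_perp// mulr0.
- move=> e; rewrite inE => /orP[/eqP ->|/V'es[]//].
  rewrite -[_ *: w]addr0; apply: (Vlin) => //.
  by rewrite -(subrr w) addrC -scaleN1r; exact: Vlin.
move=> u Vu; rewrite big_cons.
pose c := dotv l u / dotv l w.
have V'u : V' (u - c *: w).
  split; first by rewrite addrC -scaleNr; exact: Vlin.
  by rewrite dotvDr dotvNr dotvZr /c divfK// subrr.
have wu : dotv w u = c * dotv w w.
  apply/eqP; rewrite -subr_eq0 -dotvZr -dotvNr -dotvDr; apply/eqP; exact: w_perp.
rewrite dotvZl wu scalerA (_ : _ * _ = c); last by rewrite -ss; field.
rewrite addrC; apply/eqP; rewrite -subr_eq; apply/eqP.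
rewrite {1}(spanes _ V'u) big_seq [RHS]big_seq; apply: eq_bigr => e ees.
by rewrite dotvDr dotvNr dotvZr (dotvC e w) w_perp ?mulr0 ?subr0//; exact: V'es.
Qed.

(** Coordinatewise, [2 * a * b - 1/2 * b ^+ 2 <= 2 * a ^+ 2]. *)
Lemma linearize_by_basis es v x : v = \sum_(e <- es) dotv e v *: e ->
  2 * dotv x v - 2^-1 * dotv v v <= 2 * sumsq es x.
Proof.
move=> vE.
have xv y : dotv y v = \sum_(e <- es) dotv e v * dotv e y.
  by rewrite {1}vE dotv_sumr; apply: eq_bigr => e _; rewrite dotvZr (dotvC y).
rewrite !xv /sumsq !mulr_sumr -sumrB; apply: ler_sum => e _.
rewrite -subr_ge0 (_ : _ - _ = 2 * (dotv e x - 2^-1 * dotv e v) ^+ 2).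
  by rewrite mulr_ge0// sqr_ge0.
by field.
Qed.

End gram_schmidt.

Section piecewise_affine.
Context (R : realType) (n : nat).
Implicit Types (u v : 'cV[R]_n) (J K : {set 'I_n}).

Lemma WJ_linear J a u v : WJ J u -> WJ J v -> WJ J (a *: u + v).
Proof.
move=> hu hv i hi; move: (hu i hi) (hv i hi) => /eqP eu /eqP ev.
by rewrite /affine_at !mxE mulrDr ev mulrCA eu mulrDr addrACA.
Qed.

Lemma WJ_sub J K u : J \subset K -> WJ J u -> WJ K u.
Proof.
move=> JK hu i; rewrite finset.in_setD => /andP[iK iI].
apply: hu; rewrite finset.in_setD iI andbT.
by apply: contra iK; exact: (fintype.subsetP JK).
Qed.

(** Each entry is determined by the two preceding ones. *)
Lemma affine_eq0 u : (3 <= n)%N ->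
  (forall i, i \in interior_idx n -> affine_at u i) ->
  (forall i : 'I_n, (i < 2)%N -> u i 0 = 0) -> u = 0.
Proof.
move=> n3 uaff u0; apply/colP => i; rewrite mxE.
suff H k : forall i : 'I_n, (i <= k)%N -> u i 0 = 0 by exact: (H i).
elim: k => [|k IH] {}i ik; first by apply: u0; rewrite (leq_ltn_trans ik).
have [i2|i2] := ltnP i 2; first exact: u0.
have jn : (i.-1 < n)%N by rewrite (leq_ltn_trans (leq_pred _))// ltn_ord.
pose j := Ordinal jn.
have jI : j \in interior_idx n.
  rewrite inE /=; case: (nat_of_ord i) i2 (ltn_ord i) => [|[|m]]//= _.
  by case: (n).
have Sj : ordS j = i.
  apply: val_inj => /=; rewrite prednK ?modn_small ?ltn_ord//.
  exact: leq_trans i2.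
have := uaff j jI; rewrite /affine_at Sj.
rewrite !(IH j) ?(IH (ord_pred j)) ?addr0 ?mulr0; last 2 first.
- rewrite /= -subn1 -addnBAC; last by rewrite -ltnS prednK//; exact: leq_trans i2.
  rewrite modnDr modn_small; last by rewrite (leq_ltn_trans (leq_subr _ _)).
  by rewrite (leq_trans (leq_subr _ _))//= -ltnS prednK//; exact: leq_trans i2.
- by rewrite /= -ltnS prednK//; exact: leq_trans i2.
by move/eqP.
Qed.

(** A vector of [WJ J] is determined by its first two entries and by its second
differences at the indices of [J]. *)
Lemma WJ_basis J : (3 <= n)%N -> exists es : seq 'cV[R]_n,
  [/\ (size es <= #|J| + 2)%N, orthonormal es &
      forall u, WJ J u -> u = \sum_(e <- es) dotv e u *: e].
Proof.
move=> n3.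
pose pt (i : 'I_n) : 'cV[R]_n := delta_mx i 0.
have ptE i u : dotv (pt i) u = u i 0.
  rewrite /dotv (bigD1 i)//= mxE !eqxx mul1r big1 ?addr0// => j /negbTE ji.
  by rewrite mxE ji mul0r.
pose kink i := 2 *: pt i - (pt (ordS i) + pt (ord_pred i)).
have kinkE i u : dotv (kink i) u = 2 * u i 0 - (u (ordS i) 0 + u (ord_pred i) 0).
  by rewrite /kink dotvDl dotvNl dotvDl dotvZl !ptE.
pose i0 : 'I_n := Ordinal (leq_trans (isT : 0 < 3)%N n3).
pose i1 : 'I_n := Ordinal (leq_trans (isT : 1 < 3)%N n3).
have [||es [ses oes _ spanes]] :=
    @gram_schmidt R n (pt i0 :: pt i1 :: [seq kink i | i in J]) (WJ J).
- by move=> a u v; exact: WJ_linear.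
- move=> u uJ u0; apply: affine_eq0 => // i => [iI|i2].
    have [iJ|iJ] := boolP (i \in J); last by apply: uJ; rewrite inE iJ.
    rewrite /affine_at -subr_eq0 -kinkE u0 ?eqxx// !in_cons.
    by rewrite fintype.image_f ?orbT.
  have [->|->] : i = i0 \/ i = i1.
    by case: i i2 => [[|[|m]] im]//= _; [left|right]; apply: val_inj.
  - by rewrite -ptE u0// mem_head.
  - by rewrite -ptE u0// !inE eqxx orbT.
by exists es; split => //; rewrite (leq_trans ses)//= size_image addn2.
Qed.

End piecewise_affine.

Section projector.
Context (R : realType) (n : nat) (J : {set 'I_n}).
Implicit Types u v mu : 'cV[R]_n.

Lemma QJ_in v : WJ J (QJ R J *m v).
Proof. by have [] := @QJ_orthoproj R n J v. Qed.

Lemma QJ_perp v w : WJ J w -> sdot (v - QJ R J *m v) w = 0.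
Proof.
by move=> Ww; have [_ h] := @QJ_orthoproj R n J v; rewrite /sdot h// mulr0.
Qed.

Lemma sqnorm_QJ_split v w : WJ J w ->
  sqnorm (v - w) = sqnorm (v - QJ R J *m v) + sqnorm (QJ R J *m v - w).
Proof.
move=> Ww.
have -> : v - w = (v - QJ R J *m v) + (QJ R J *m v - w) by rewrite addrA subrK.
rewrite sqnormD QJ_perp ?mulr0 ?addr0//.
by apply: WJB => //; exact: QJ_in.
Qed.

Lemma WJ0 : WJ J (0 : 'cV[R]_n).
Proof. by rewrite -(subrr (QJ R J *m 0)); apply: WJB; exact: QJ_in. Qed.

Lemma sqnorm_QJ_residual_le v : sqnorm (QJ R J *m v - v) <= sqnorm v.
Proof.
have := sqnorm_QJ_split v WJ0; rewrite !subr0 => ->.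
by rewrite -sqnormN opprB lerDl sqnorm_ge0.
Qed.

Lemma sqnorm_QJ_le v : sqnorm (QJ R J *m v) <= sqnorm v.
Proof.
have := sqnorm_QJ_split v WJ0; rewrite !subr0 => ->.
by rewrite lerDr sqnorm_ge0.
Qed.

(** The bias [mu - QJ R J *m mu] is orthogonal to the projected noise and is
minimal among the distances from [mu] to [WJ J].  This is why the oracle bound
has the leading constant [1]. *)
Lemma sqnorm_QJ_risk mu x u : WJ J u ->
  sqnorm (QJ R J *m (mu + x) - mu) <= sqnorm (mu - u) + sqnorm (QJ R J *m x).
Proof.
move=> Wu.
have -> : QJ R J *m (mu + x) - mu = QJ R J *m x - (mu - QJ R J *m mu).
  by rewrite mulmxDr opprB addrCA addrA addrAC.
rewrite [X in X <= _]sqnormB sdotC QJ_perp; last exact: QJ_in.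
rewrite mulr0 subr0 addrC lerD2r (sqnorm_QJ_split mu Wu).
by rewrite lerDl sqnorm_ge0.
Qed.

End projector.

(** * Stability of Q-aggregation and measurability *)

(** The vectors to be aggregated are now linear functions of the data that
contract the norm, as do their residuals. *)
Section Q_aggregation_of_projectors.
Context (R : realType) (n : nat) (I : finType) (D : pred I) (T : I -> 'M[R]_n).
Hypothesis T_le : forall i (v : 'cV[R]_n), sqnorm (T i *m v) <= sqnorm v.
Hypothesis residual_le : forall i (v : 'cV[R]_n), sqnorm (T i *m v - v) <= sqnorm v.
Implicit Types (y h v : 'cV[R]_n) (pen theta : I -> R).

Let est y i : 'cV[R]_n := T i *m y.

Let sum_weights_le theta (f : I -> R) b : weights D theta -> (forall i, f i <= b) ->
  \sum_(i | D i) theta i * f i <= b.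
Proof.
move=> th fb; rewrite -[leRHS]mul1r -[X in _ <= X * b]th.2 mulr_suml.
by apply: ler_sum => i Di; rewrite ler_wpM2l// th.1.
Qed.

Let aggregateD y h theta :
  aggregate D (est (y + h)) theta = aggregate D (est y) theta + aggregate D (est h) theta.
Proof. by rewrite -big_split; apply: eq_bigr => i _; rewrite /est mulmxDr scalerDr. Qed.

Let aggregate_residual y theta : weights D theta ->
  aggregate D (est y) theta - y = aggregate D (fun i => T i *m y - y) theta.
Proof.
move=> th; rewrite -[X in _ - X]scale1r -[X in X *: y]th.2 scaler_suml -sumrB.
by apply: eq_bigr => i _; rewrite scalerBr.
Qed.

Let residual_bound theta v : weights D theta ->
  2^-1 * sqnorm (aggregate D (est v) theta - v) +
  \sum_(i | D i) theta i * (2^-1 * sqnorm (est v i - v)) <= sqnorm v.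
Proof.
move=> th.
have H1 : sqnorm (aggregate D (est v) theta - v) <= sqnorm v.
  rewrite aggregate_residual//; apply: le_trans (sqnorm_aggregate_le _ th) _.
  exact: sum_weights_le.
have H2 : \sum_(i | D i) theta i * (2^-1 * sqnorm (est v i - v)) <= 2^-1 * sqnorm v.
  by apply: sum_weights_le => // i; rewrite ler_pM2l ?residual_le// invr_gt0.
lra.
Qed.

(** A change [h] of the data changes each residual by the residual of [h].  The
parameter [eta] is to be tuned: the objective is quadratic in the data, so its
modulus of continuity depends on the size of [y]. *)
Lemma Qobj_perturb pen y h theta (eta : R) : weights D theta -> 0 < eta ->
  Qobj D (est (y + h)) pen (y + h) theta <=
  Qobj D (est y) pen y theta + eta * sqnorm y + (1 + eta^-1) * sqnorm h.
Proof.
move=> th eta0; rewrite !QobjE_residual//.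
have eta10 : 0 < 1 + eta^-1 by rewrite addr_gt0// invr_gt0.
have H1 := sqnormD_le (aggregate D (est y) theta - y) (aggregate D (est h) theta - h) eta0.
rewrite [X in sqnorm X](_ : _ = aggregate D (est (y + h)) theta - (y + h)) in H1; last first.
  by rewrite aggregateD opprD addrACA.
have H2 : \sum_(i | D i) theta i * (pen i + 2^-1 * sqnorm (est (y + h) i - (y + h))) <=
    \sum_(i | D i) theta i * (pen i + 2^-1 * sqnorm (est y i - y)) +
    eta * (\sum_(i | D i) theta i * (2^-1 * sqnorm (est y i - y))) +
    (1 + eta^-1) * (\sum_(i | D i) theta i * (2^-1 * sqnorm (est h i - h))).
  rewrite !mulr_sumr -!big_split/=; apply: ler_sum => i Di.
  have H := sqnormD_le (est y i - y) (est h i - h) eta0.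
  rewrite [X in sqnorm X](_ : _ = est (y + h) i - (y + h)) in H; last first.
    by rewrite /est mulmxDr opprD addrACA.
  have := ler_wpM2l (th.1 i Di) H; lra.
have H3 := ler_wpM2l (ltW eta0) (residual_bound y th).
have H4 := ler_wpM2l (ltW eta10) (residual_bound h th).
lra.
Qed.

(** By strong convexity the minimizer for [y'] is bad for [y] unless its aggregate
is close to the one for [y], while the objectives for [y] and [y'] are close.
Taking [y' = y] shows that the aggregate does not depend on the choice of the
minimizer. *)
Lemma Qaggregation_stability pen y y' theta theta' (eta : R) : 0 < eta ->
  weights D theta ->
  (forall t, weights D t -> Qobj D (est y) pen y theta <= Qobj D (est y) pen y t) ->
  weights D theta' ->
  (forall t, weights D t -> Qobj D (est y') pen y' theta' <= Qobj D (est y') pen y' t) ->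
  sqnorm (aggregate D (est y') theta' - aggregate D (est y) theta) <=
  4 * eta * (sqnorm y + sqnorm y') + (10 + 8 * eta^-1) * sqnorm (y' - y).
Proof.
move=> eta0 th thmin th' thmin'; set h := y' - y.
have yh : y' = y + h by rewrite /h subrKC.
have yh' : y = y' - h by rewrite /h opprB subrKC.
have H1 := Qobj_strong_convexity th thmin th'.
have H2 := Qobj_perturb pen y' (- h) th' eta0.
have H3 := Qobj_perturb pen y h th eta0.
rewrite -yh' sqnormN in H2; rewrite -yh in H3.
have H4 := thmin' _ th.
have H5 : sqnorm (aggregate D (est h) theta') <= sqnorm h.
  apply: le_trans (sqnorm_aggregate_le _ th') _.
  by apply: sum_weights_le => // i; exact: T_le.
have := sqnormD_le (aggregate D (est y) theta' - aggregate D (est y) theta)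
  (aggregate D (est h) theta') ltr01.
rewrite addrAC -aggregateD -yh invr1 => H6.
lra.
Qed.

End Q_aggregation_of_projectors.

(** The set where [a < f (X w)] is a countable union, over the boxes with rational
center and radius [1 / k.+1] on which [a < f], of the preimages of these
boxes. *)
Lemma measurable_fun_continuous (R : realType) (n : nat) (d : measure_display)
    (Omega : measurableType d) (X : Omega -> 'cV[R]_n) (f : 'cV[R]_n -> R) :
  (forall i, measurable_fun setT (fun w => X w i 0)) ->
  (forall (y : 'cV[R]_n) (e : R), 0 < e -> exists2 del : R, 0 < del &
     forall y' : 'cV[R]_n, (forall i, `|y' i 0 - y i 0| < del) -> `|f y' - f y| < e) ->
  measurable_fun setT (fun w => f (X w)).
Proof.
move=> mX cf.
apply: (measurability _ (RGenOInfty.measurableE R)).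
move=> _ [_ [a ->] <-]; rewrite setTI.
pose box (q : 'cV[rat]_n * nat) : set 'cV[R]_n :=
  [set y | forall i, `|y i 0 - ratr (q.1 i 0)| < q.2.+1%:R^-1].
pose F q : set Omega := [set w | box q `<=` [set y | a < f y] /\ box q (X w)].
rewrite (_ : _ @^-1` _ = \bigcup_q F q); last first.
  apply/seteqP; split => [w /=|w [q _ [qf qw]]]; last first.
    by rewrite /= in_itv/= andbT; exact: qf.
  rewrite in_itv/= andbT => afw.
  have af0 : 0 < f (X w) - a by rewrite subr_gt0.
  have [del del0 hdel] := cf (X w) _ af0.
  pose k := Num.trunc (2 / del).
  have k0 : (0 : R) < k.+1%:R^-1 by rewrite invr_gt0.
  have kdel : 2 * k.+1%:R^-1 < del.
    by rewrite ltr_pdivrMr// mulrC -ltr_pdivrMr// truncnS_gt.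
  have [q qP] : {q : 'I_n -> rat & forall i, `|X w i 0 - ratr (q i)| < k.+1%:R^-1}.
    apply: (@choice _ _ (fun i (r : rat) => `|X w i 0 - ratr r| < k.+1%:R^-1)) => i.
    have [r] := rat_in_itvoo (ltr_pwDr k0 (lexx (X w i 0))).
    rewrite in_itv/= => /andP[r1 r2]; exists r; rewrite ltr_norml.
    by move: k0 r2; set t := k.+1%:R^-1 => k0 r2; apply/andP; split; lra.
  exists (\col_i q i, k) => //; split; last by move=> i /=; rewrite mxE.
  move=> y' /= hy'; have := hdel y'; rewrite ltr_norml => H.
  have /H/andP[] : forall i, `|y' i 0 - X w i 0| < del.
    move=> i; apply: le_lt_trans kdel.
    rewrite mulr_natl mulr2n (le_trans (ler_distD (ratr (q i)) _ _))//.
    by rewrite lerD//; [have := hy' i; rewrite mxE => /ltW|rewrite distrC ltW].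
  lra.
apply: countable_bigcupT_measurable => [|q]; first exact: countableP.
have [qf|qf] := pselect (box q `<=` [set y | a < f y]); last first.
  by rewrite (_ : F q = set0)//; apply/seteqP; split => w //= [].
rewrite (_ : F q = \bigcap_(i in [set: 'I_n])
  (fun w => `|X w i 0 - ratr (q.1 i 0)|) @^-1` `]-oo, q.2.+1%:R^-1[); last first.
  apply/seteqP; split => [w [_ wq] i _|w H]; first by rewrite /= in_itv/=; exact: wq.
  by split=> // i; have := H i I; rewrite /= in_itv.
apply: fin_bigcap_measurable => // i _.
rewrite -[X in measurable X]setTI.
have mi : measurable_fun setT (fun w => `|X w i 0 - ratr (q.1 i 0)|).
  by apply: measurableT_comp => //; exact: measurable_funB.
exact: mi.
Qed.

(** * The prior weights and the entropy function *)

Section prior.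
Context (R : realType) (n : nat).
Hypothesis n3 : (3 <= n)%N.
Implicit Types J : {set 'I_n}.

Lemma sum_subsets (A : {set 'I_n}) (g : nat -> R) :
  \sum_(J : {set 'I_n} | J \subset A) g #|J| =
  \sum_(k < #|A|.+1) 'C(#|A|, k)%:R * g k.
Proof.
rewrite (partition_big (fun J : {set 'I_n} => inord #|J| : 'I_#|A|.+1) xpredT)//=.
apply: eq_bigr => k _.
have E (J : {set 'I_n}) : (J \subset A) && (inord #|J| == k :> 'I_#|A|.+1) =
    (J \in [set B : {set 'I_n} | B \subset A & #|B| == k]%SET).
  rewrite inE; have [JA|//] := boolP (J \subset A).
  by rewrite -val_eqE /= inordK// ltnS subset_leq_card.
rewrite (eq_bigl _ _ E) (eq_bigr (fun=> g k)); last first.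
  by move=> J; rewrite inE => /andP[_ /eqP ->].
by rewrite sumr_const cards_draws mulr_natl.
Qed.

Lemma card_interior_idx : #|interior_idx n| = (n - 2)%N.
Proof.
have h (k : 'I_(n - 2)) : (k.+1 < n)%N by have := ltn_ord k; lia.
rewrite -[RHS]card_ord -(card_imset (f := fun k => Ordinal (h k))); last first.
  by move=> k l /(congr1 val) /= [] /val_inj.
apply: eq_card => i; rewrite inE; apply/idP/imsetP => [/andP[i0 i1]|[k _ ->]/=].
  have ik : (i.-1 < n - 2)%N by move: i0 i1; lia.
  by exists (Ordinal ik) => //; apply: val_inj; rewrite /= prednK.
by have := ltn_ord k; lia.
Qed.

Lemma card_sub_interior J : J \subset interior_idx n -> (#|J| <= n - 2)%N.
Proof. by move=> /subset_leq_card; rewrite card_interior_idx. Qed.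

Lemma HC_ge1 : 1 <= HC R n.
Proof.
rewrite /HC big_nat_recl//= mulr0n oppr0 expR0 lerDl.
by apply: sumr_ge0 => i _.
Qed.

Lemma HC_gt0 : 0 < HC R n. Proof. exact: lt_le_trans HC_ge1. Qed.

(** The terms are dominated by those of the geometric series of ratio [1/2],
as [2 <= expR 1]. *)
Lemma HC_le2 : HC R n <= 2.
Proof.
have e2 : expR (-1) <= 2^-1 :> R.
  rewrite expRN lef_pV2 ?posrE ?expR_gt0//.
  by apply: le_trans (expR_ge1Dx 1); rewrite -natr1 addrC.
suff H k : \sum_(0 <= i < k) expR (- i%:R) <= 2 - 2 * 2^-1 ^+ k :> R.
  by apply: le_trans (H _) _; rewrite gerBl mulr_ge0// exprn_ge0// invr_ge0.
elim: k => [|k IH]; first by rewrite big_geq// expr0 mulr1 subrr.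
rewrite big_nat_recr//= exprS.
have : expR (- k%:R) <= 2^-1 ^+ k :> R.
  rewrite -[- _]mulN1r mulrC expRM_natl.
  by rewrite lerXn2r ?nnegrE ?invr_ge0// expR_ge0.
lra.
Qed.

Lemma sum_nu : \sum_(J : {set 'I_n} | J \subset interior_idx n) nu R J = 1.
Proof.
rewrite (sum_subsets (interior_idx n)
  (fun k => expR (- k%:R) / (HC R n * 'C(n - 2, k)%:R))).
rewrite card_interior_idx.
transitivity ((\sum_(k < (n - 2).+1) expR (- k%:R)) / HC R n).
  rewrite mulr_suml; apply: eq_bigr => k _.
  have C0 : 'C(n - 2, k)%:R != 0 :> R by rewrite pnatr_eq0 -lt0n bin_gt0 -ltnS.
  by field; rewrite C0 gt_eqF// HC_gt0.
by rewrite -(big_mkord xpredT (fun k => expR (- k%:R))) -/(HC R n) divff// gt_eqF// HC_gt0.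
Qed.

Lemma nu_gt0 J : J \subset interior_idx n -> 0 < nu R J.
Proof.
move=> /card_sub_interior JI.
by rewrite divr_gt0 ?expR_gt0// mulr_gt0 ?HC_gt0// ltr0n bin_gt0.
Qed.

Lemma ln_inv_nu J : J \subset interior_idx n ->
  ln (1 / nu R J) = #|J|%:R + ln (HC R n) + ln 'C(n - 2, #|J|)%:R.
Proof.
move=> JI; have C0 : (0 : R) < 'C(n - 2, #|J|)%:R.
  by rewrite ltr0n bin_gt0 card_sub_interior.
rewrite div1r lnV ?posrE ?nu_gt0// /nu ln_div ?posrE ?expR_gt0//; last first.
  by rewrite mulr_gt0 ?HC_gt0.
by rewrite expRK lnM ?posrE ?HC_gt0//; ring.
Qed.

Lemma ln_inv_nu_ge J : J \subset interior_idx n -> #|J|%:R <= ln (1 / nu R J).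
Proof.
move=> JI; rewrite ln_inv_nu// -addrA lerDl addr_ge0// ln_ge0 ?HC_ge1//.
by rewrite ler1n bin_gt0 card_sub_interior.
Qed.

End prior.

Section entropy.
Context (R : realType) (n : nat).

(** The factor [log (e n / q)] of the oracle bound. *)
Definition logratio (q : nat) : R := ln (expR 1 * n%:R / q%:R).

Lemma logratioE q : (0 < q)%N -> (0 < n)%N ->
  logratio q = 1 + ln n%:R - ln q%:R.
Proof.
move=> q0 n0; rewrite /logratio ln_div ?posrE ?mulr_gt0 ?expR_gt0 ?ltr0n//.
by rewrite lnM ?posrE ?expR_gt0 ?ltr0n// expRK.
Qed.

Lemma logratio_ge1 q : (0 < q <= n)%N -> 1 <= logratio q.
Proof.
move=> /andP[q0 qn]; have n0 := leq_trans q0 qn.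
rewrite logratioE// -addrA lerDl subr_ge0 ler_ln ?posrE ?ltr0n//.
by rewrite ler_nat.
Qed.

(** From [ln x <= x - 1] one gets
[p * logratio p <= p * logratio q + (q - p)], and [1 <= logratio q]. *)
Lemma logratio_mono p q : (0 < p)%N -> (p <= q <= n)%N ->
  p%:R * logratio p <= q%:R * logratio q.
Proof.
move=> p0 /andP[pq qn]; have q0 := leq_trans p0 pq; have n0 := leq_trans q0 qn.
have pR : (0 : R) < p%:R by rewrite ltr0n.
have qR : (0 : R) < q%:R by rewrite ltr0n.
have L1 : 1 <= logratio q by rewrite logratio_ge1// q0.
have pqR : p%:R <= q%:R :> R by rewrite ler_nat.
have H : logratio p - logratio q <= q%:R / p%:R - 1.
  rewrite !logratioE// [leLHS](_ : _ = ln (1 + (q%:R / p%:R - 1))).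
    apply: le_ln1Dx; have := divr_gt0 qR pR; lra.
  by rewrite subrKC ln_div ?posrE//; ring.
have := ler_wpM2l (ltW pR) H.
rewrite mulrBr [X in _ <= X]mulrBr mulrCA divff ?gt_eqF// mulr1 => H1.
have : 0 <= (q%:R - p%:R) * (logratio q - 1) by rewrite mulr_ge0// subr_ge0.
nra.
Qed.

(** With [x := k.+1 / n], the binomial theorem gives
[C(m, k) * x ^+ k <= (1 + x) ^+ m <= expR (m * x) <= expR k.+1]. *)
Lemma bin_le_entropy m k : (m <= n)%N -> (k < n)%N ->
  ln 'C(m, k)%:R <= k.+1%:R * logratio k.+1.
Proof.
move=> mn kn; have n0 : (0 < n)%N by rewrite (leq_trans _ kn).
have L1 : 1 <= logratio k.+1 by rewrite logratio_ge1.
have [mk|km] := ltnP m k.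
  by rewrite bin_small// ln0// mulr_ge0// (le_trans _ L1).
have nR : (0 : R) < n%:R by rewrite ltr0n.
pose x : R := k.+1%:R / n%:R.
have x0 : 0 < x by rewrite divr_gt0.
have C0 : (0 : R) < 'C(m, k)%:R by rewrite ltr0n bin_gt0.
have H : 'C(m, k)%:R * x ^+ k <= expR k.+1%:R.
  apply: (@le_trans _ _ ((1 + x) ^+ m)).
    rewrite exprDn.
    pose F (i : 'I_m.+1) : R := 1 ^+ (m - i) * x ^+ i *+ 'C(m, i).
    rewrite [leRHS](bigD1 (Ordinal (km : (k < m.+1)%N)))//= -/F.
    rewrite expr1n mul1r mulr_natl lerDl.
    by apply: sumr_ge0 => i _; rewrite /F expr1n mul1r mulrn_wge0// exprn_ge0// ltW.
  apply: (@le_trans _ _ (expR x ^+ m)).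
    by rewrite lerXn2r ?nnegrE ?expR_ge0 ?expR_ge1Dx// addr_ge0// ltW.
  rewrite -expRM_natr ler_expR /x mulrAC ler_pdivrMr// ler_wpM2l//.
  by rewrite ler_nat.
have : ln ('C(m, k)%:R * x ^+ k) <= k.+1%:R.
  by rewrite -[leRHS]expRK ler_ln ?posrE ?expR_gt0// mulr_gt0// exprn_gt0.
rewrite lnM ?posrE// ?exprn_gt0// lnXn// /x ln_div ?posrE// -mulr_natl => H1.
have := L1; rewrite logratioE// => L1'.
rewrite -[k.+1%:R]natr1 in H1 L1' *.
move: (ln (k%:R + 1)) (ln n%:R) H1 L1' => a b H1 L1'.
have := ler0n R k; nra.
Qed.

End entropy.

(** * The estimator: risk bound for a fixed noise, and measurability of the loss *)

Section penalty.
Context (R : realType) (n : nat) (sigma : R).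
Hypothesis n3 : (3 <= n)%N.
Implicit Types (J : {set 'I_n}) (u mu y x : 'cV[R]_n).

(** The penalty of [J] in the objective, in units of [sigma ^+ 2 / n]. *)
Definition penalty J : R := 2 * #|J|%:R + 46 * ln (1 / nu R J).

Definition kinks u : {set 'I_n} := [set i in interior_idx n | ~~ affine_at u i]%SET.

Lemma kinks_interior u : kinks u \subset interior_idx n.
Proof. by apply/fintype.subsetP => i; rewrite inE => /andP[]. Qed.

Lemma WJ_kinks u : WJ (kinks u) u.
Proof. by move=> i; rewrite !inE => /andP[+ ii]; rewrite ii/= negbK. Qed.

Lemma kinks_WJ J u : WJ J u -> kinks u \subset J.
Proof.
move=> Wu; apply/fintype.subsetP => i; rewrite inE => /andP[ii].
by apply: contraR => iJ; apply: Wu; rewrite finset.in_setD iJ.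
Qed.

Lemma card_kinks_lt u : (#|kinks u| < n)%N.
Proof. by have := card_sub_interior n3 (kinks_interior u); lia. Qed.

(** The penalty does not exceed the rate of the oracle bound: in [ln_inv_nu], the
terms [#|J|] and [ln (HC R n)] add up to at most [#|J|.+1], and the binomial
term is bounded by [bin_le_entropy]. *)
Lemma penalty_le J : J \subset interior_idx n ->
  penalty J <= 94 * (#|J|.+1%:R * logratio R n #|J|.+1).
Proof.
move=> JI; have Jn := card_sub_interior n3 JI.
have H1 : ln 'C(n - 2, #|J|)%:R <= #|J|.+1%:R * logratio R n #|J|.+1.
  by apply: bin_le_entropy; lia.
have L1 : 1 <= logratio R n #|J|.+1 by apply: logratio_ge1; lia.
have H2 : ln (HC R n) <= 1.
  rewrite -[leRHS]expRK ler_ln ?posrE ?expR_gt0 ?HC_gt0//.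
  by apply: le_trans (HC_le2 R n) _; apply: le_trans (expR_ge1Dx 1).
have H3 : #|J|.+1%:R <= #|J|.+1%:R * logratio R n #|J|.+1 by rewrite ler_peMr.
rewrite /penalty ln_inv_nu//; move: H1 H3; set T := #|J|.+1%:R * _.
rewrite -natr1; lra.
Qed.

(** Projecting [mu] onto [WJ (kinks u)] decreases the distance to [mu] and creates
no new kink. *)
Lemma oracle_QJ_kinks_le c mu u : 0 <= c ->
  oracle c sigma mu (QJ R (kinks u) *m mu) <= oracle c sigma mu u.
Proof.
move=> c0; rewrite /oracle lerD//.
  by rewrite (sqnorm_QJ_split mu (@WJ_kinks u)) lerDl sqnorm_ge0.
set v := QJ R _ *m _.
have H : (qkinks v)%:R * logratio R n (qkinks v) <=
         (qkinks u)%:R * logratio R n (qkinks u).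
  apply: logratio_mono => //; rewrite ltnS subset_leq_card ?card_kinks_lt//.
  by apply: kinks_WJ; exact: QJ_in.
have E q : c * sigma ^+ 2 * q%:R / n%:R * ln (expR 1 * n%:R / q%:R) =
    c * sigma ^+ 2 / n%:R * (q%:R * logratio R n q) by rewrite /logratio; ring.
by rewrite !E ler_wpM2l// divr_ge0// mulr_ge0// sqr_ge0.
Qed.

Lemma oracle_minimum c mu : 0 <= c -> exists m, is_minimum (oracle c sigma mu) m.
Proof.
move=> c0; pose f J := oracle c sigma mu (QJ R J *m mu).
have [J _ Jmin] := @arg_minP _ _ _ finset.set0 xpredT f isT.
exists (f J); split; first by exists (QJ R J *m mu).
by move=> u; apply: le_trans (oracle_QJ_kinks_le _ _ c0); exact: Jmin.
Qed.

Definition interior_set : pred {set 'I_n} := fun J => J \subset interior_idx n.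

Lemma Qobjective_Qobj y theta : Qobjective sigma y theta =
  Qobj interior_set (fun J => QJ R J *m y)
    (fun J => sigma ^+ 2 / n%:R * penalty J) y theta.
Proof.
rewrite /Qobjective /Qobj; congr (_ + _); apply: eq_bigr => J _.
by rewrite -/(mu_theta y theta) /penalty; congr (_ * _); ring.
Qed.

Variable muhat : 'cV[R]_n -> 'cV[R]_n.
Hypothesis muhatP : is_Qconv_estimator sigma muhat.

Lemma Qconv_aggregate y : exists theta, let D := interior_set in
  let est := fun J => QJ R J *m y in
  let pen := fun J => sigma ^+ 2 / n%:R * penalty J in
  [/\ weights D theta, forall t, weights D t -> Qobj D est pen y theta <= Qobj D est pen y t &
      muhat y = aggregate D est theta].
Proof.
have [theta [th thmin muE]] := muhatP y.
exists theta; split => // t wt.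
by rewrite -!Qobjective_Qobj; exact: thmin.
Qed.

(** The probabilistic part enters only through [X], which bounds the projected
noise minus the penalty for all [J] simultaneously.  The case [J = J0] of that
bound also controls the noise of the reference projector. *)
Lemma loss_deterministic (es : {set 'I_n} -> seq 'cV[R]_n) mu u x (X : R) J0 :
  (forall J v, WJ J v -> v = \sum_(e <- es J) dotv e v *: e) ->
  J0 \subset interior_idx n -> WJ J0 u ->
  (forall J, J \subset interior_idx n ->
     2 * sumsq (es (J :|: J0)%SET) x - sigma ^+ 2 * penalty J <= sigma ^+ 2 * X) ->
  sqnorm (muhat (mu + x) - mu) <=
  sqnorm (mu - u) + sigma ^+ 2 / n%:R * (2 * penalty J0 + 2 * X).
Proof.
move=> esP J0I uJ0 HX; have [theta [th thmin ->]] := Qconv_aggregate (mu + x).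
apply: le_trans (Qaggregation_oracle mu th thmin (J0I : interior_set J0)) _.
have nR : (0 : R) < n%:R by rewrite ltr0n; lia.
have ni : 0 <= n%:R^-1 :> R by rewrite invr_ge0 ltW.
have H1 : \sum_(J | interior_set J) theta J *
    (2 * sdot (mu + x - mu) (QJ R J *m (mu + x) - QJ R J0 *m (mu + x)) -
     2^-1 * sqnorm (QJ R J *m (mu + x) - QJ R J0 *m (mu + x)) -
     sigma ^+ 2 / n%:R * penalty J) <= sigma ^+ 2 / n%:R * X.
  rewrite -[leRHS]mul1r -[X in _ <= X * _]th.2 mulr_suml.
  apply: ler_sum => J JI; apply: ler_wpM2l; first exact: th.1.
  rewrite (_ : mu + x - mu = x); last by rewrite addrAC subrr add0r.
  set v := QJ R J *m _ - _.
  have Wv : WJ (J :|: J0)%SET v.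
    apply: WJB; [apply: (@WJ_sub _ _ J)|apply: (@WJ_sub _ _ J0)].
    - exact: finset.subsetUl.
    - exact: QJ_in.
    - exact: finset.subsetUr.
    - exact: QJ_in.
  have H := le_trans (linearize_by_basis x (esP _ _ Wv)) (lexx _).
  have := ler_wpM2l ni (le_trans (lerB H (lexx (sigma ^+ 2 * penalty J))) (HX J JI)).
  by congr (_ <= _); rewrite ?sqnormE /sdot; ring.
have H2 : sqnorm (QJ R J0 *m x) <= sigma ^+ 2 / n%:R * (penalty J0 + X).
  set v := QJ R J0 *m x.
  have Wv : WJ J0 v by exact: QJ_in.
  have xv : dotv x v = dotv v v.
    apply/eqP; rewrite -subr_eq0 -dotvNl -dotvDl.
    by have [_ ->] := @QJ_orthoproj R n J0 x.
  have H := linearize_by_basis x (esP _ _ Wv); rewrite xv in H.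
  have := HX J0 J0I; rewrite finset.setUid => H'.
  have vv := dotv_ge0 v.
  have : dotv v v <= sigma ^+ 2 * (penalty J0 + X) by lra.
  by move=> /(ler_wpM2l ni); rewrite sqnormE /sdot; congr (_ <= _); ring.
have H3 := sqnorm_QJ_risk mu x uJ0.
rewrite /= in H1 *; lra.
Qed.

(** Each coordinate of the estimator is continuous by [Qaggregation_stability]:
given [e], first [eta] is chosen to make the term in [sqnorm y] small, then
the distance between the data. *)
Lemma loss_measurable mu d (Omega : measurableType d) (P : probability Omega R)
    (xi : 'I_n -> {RV P >-> R}) :
  measurable_fun setT (fun w => sqnorm (muhat (observation mu xi w) - mu)).
Proof.
have nR : (0 : R) < n%:R by rewrite ltr0n; lia.
have mc i : measurable_fun setT (fun w => muhat (observation mu xi w) i 0).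
  apply: (@measurable_fun_continuous _ _ _ _ _ (fun y => muhat y i 0)) => [j|y e e0].
    under eq_fun do rewrite !mxE.
    exact: measurable_funD.
  pose s := sqnorm y; have s0 : 0 <= s by exact: sqnorm_ge0.
  have e20 : 0 < e ^+ 2 by rewrite exprn_gt0.
  (* These constants split the allowance [e ^+ 2 / n] for the squared distance
     between the estimators: at most [3/8] of it comes from the size of [y], and
     half of it from the distance between [y] and [y']. *)
  pose eta := e ^+ 2 / (32 * n%:R * (s + 1)).
  have eta0 : 0 < eta by rewrite divr_gt0 ?mulr_gt0//; lra.
  have etai0 : 0 < eta^-1 by rewrite invr_gt0.
  pose C := 10 + 8 * eta^-1 + 8 * eta.
  have C0 : 0 < C by rewrite /C; lra.
  pose del := Num.min 1 (e ^+ 2 / (2 * n%:R * C)).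
  have del0 : 0 < del by rewrite lt_min ltr01 divr_gt0// !mulr_gt0.
  exists del => // y' hy'.
  have hh : sqnorm (y' - y) <= del.
    rewrite /sqnorm ler_pdivrMl//.
    apply: (@le_trans _ _ (\sum_(j < n) del)); last first.
      by rewrite sumr_const card_ord mulr_natl.
    apply: ler_sum => j _; rewrite !mxE -real_normK ?num_real//.
    apply: (@le_trans _ _ (del ^+ 2)).
      by rewrite lerXn2r ?nnegrE ?normr_ge0 ?(ltW del0)// ltW.
    by rewrite expr2 ger_pMr// ge_min lexx.
  have [th [w1 m1 E1]] := Qconv_aggregate y.
  have [th' [w2 m2 E2]] := Qconv_aggregate y'.
  have := Qaggregation_stability (@sqnorm_QJ_le R n) (@sqnorm_QJ_residual_le R n) eta0 w1 m1 w2 m2.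
  rewrite -E1 -E2 => H.
  have H' := sqnormD_le y (y' - y) ltr01; rewrite subrKC invr1 in H'.
  have H2 : sqnorm (muhat y' - muhat y) <= 12 * eta * s + C * del.
    apply: le_trans H _.
    have := ler_wpM2l (ltW eta0) H'.
    have := ler_wpM2l (ltW C0) hh.
    rewrite /C -/s; lra.
  have H3 : (muhat y' i 0 - muhat y i 0) ^+ 2 <= n%:R * sqnorm (muhat y' - muhat y).
    rewrite /sqnorm mulrA divff ?gt_eqF// mul1r (bigD1 i)//= !mxE lerDl.
    by apply: sumr_ge0 => j _; exact: sqr_ge0.
  have H4 : C * del <= e ^+ 2 / (2 * n%:R).
    rewrite (_ : e ^+ 2 / (2 * n%:R) = C * (e ^+ 2 / (2 * n%:R * C))); last first.
      by field; rewrite !gt_eqF.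
    by rewrite ler_pM2l// ge_min lexx orbT.
  have H5 : 12 * eta * s <= 12 / 32 * (e ^+ 2 / n%:R).
    rewrite (_ : 12 * eta * s = 12 / 32 * (e ^+ 2 / n%:R) * (s / (s + 1))); last first.
      by rewrite /eta; field; rewrite !gt_eqF//; lra.
    rewrite ler_piMr// ?ler_pdivrMr; [|lra|lra].
    by rewrite mulr_ge0// divr_ge0// ltW.
  rewrite -(@ltr_pXn2r _ 2)// ?nnegrE ?normr_ge0 ?(ltW e0)//.
  rewrite real_normK ?num_real//; apply: (le_lt_trans H3).
  rewrite -ltr_pdivlMl//; apply: le_lt_trans H2 _.
  have : 0 < e ^+ 2 / n%:R by rewrite divr_gt0.
  have E6 : e ^+ 2 / (2 * n%:R) = 2^-1 * (e ^+ 2 / n%:R) by field; rewrite gt_eqF.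
  rewrite E6 in H4; rewrite [X in _ < X]mulrC; lra.
rewrite /sqnorm; apply: measurable_funM => //.
apply: measurable_sum => i; apply: measurable_funX.
under eq_fun do rewrite !mxE.
exact: measurable_funB.
Qed.

End penalty.

(** * The oracle inequalities *)

Lemma measurable_sublevel (R : realType) (d : measure_display)
    (Omega : measurableType d) (f : Omega -> R) (b : R) :
  measurable_fun setT f -> measurable [set w | f w <= b].
Proof.
move=> mf; have : measurable (f @^-1` `]-oo, b]).
  by rewrite -[X in measurable X]setTI; exact: mf.
by congr measurable; apply/seteqP; split => w /=; rewrite in_itv.
Qed.

Lemma markov_sublevel (R : realType) (d : measure_display) (Omega : measurableType d)
    (P : probability Omega R) (Z : Omega -> R) (a delta : R) :
  measurable_fun setT Z -> (forall w, 0 <= Z w) ->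
  (\int[P]_w (Z w)%:E <= a%:E)%E -> 0 < a -> 0 < delta ->
  ((1 - delta)%:E <= P [set w | Z w <= a / delta]%R)%E.
Proof.
move=> mZ Z0 EZ a0 del0.
have mS : measurable [set w | Z w <= a / delta] by exact: measurable_sublevel.
set S := [set w | _] in mS *.
have H : ((a / delta)%:E * P (~` S) <= a%:E)%E.
  apply: le_trans EZ.
  rewrite -integral_cst//; last exact: measurableC.
  apply: (@le_trans _ _ (\int[P]_(w in ~` S) (Z w)%:E)%E).
    apply: ge0_le_integral => //.
    - exact: measurableC.
    - by move=> w _; rewrite lee_fin divr_ge0// ltW.
    - by apply: measurable_funTS; exact/measurable_EFinP.
    - by move=> w /= /negP; rewrite -ltNge lee_fin => /ltW.
  apply: ge0_subset_integral => //.
  - exact: measurableC.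
  - exact/measurable_EFinP.
  - by move=> w _; rewrite lee_fin.
have PS : P S \is a fin_num by exact: fin_num_measure.
move: H; rewrite probability_setC// -(fineK PS) -EFinD -EFinM !lee_fin => H.
have : 1 - fine (P S) <= delta; last lra.
rewrite -(ler_pM2l (divr_gt0 a0 del0)); apply: le_trans H _.
by rewrite divfK// gt_eqF.
Qed.

(** A loss dominated by an affine function of [ln Y], with [Y] of mean at most
one, obeys a deviation bound and a bound in expectation. *)
Section log_domination.
Context (R : realType) (d : measure_display) (Omega : measurableType d).
Context (P : probability Omega R) (f Y : Omega -> R) (b k : R).
Hypotheses (mf : measurable_fun setT f) (mY : measurable_fun setT Y).
Hypotheses (Y0 : forall w, 0 < Y w) (EY : (\int[P]_w (Y w)%:E <= 1%:E)%E).
Hypotheses (k0 : 0 <= k) (fY : forall w, f w <= b + k * ln (Y w)).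

Lemma log_domination_tail delta : 0 < delta ->
  ((1 - delta)%:E <= P [set w | f w <= b + k * ln (1 / delta)]%R)%E.
Proof.
move=> d0.
apply: le_trans (markov_sublevel mY (fun w => ltW (Y0 w)) EY ltr01 d0) _.
apply: le_measure; rewrite ?inE; [exact: measurable_sublevel..|].
move=> w /= Yw; apply: le_trans (fY w) _.
by rewrite lerD2l ler_wpM2l// ler_ln ?posrE ?divr_gt0.
Qed.

Lemma log_domination_expectation : 0 <= b -> (forall w, 0 <= f w) ->
  (\int[P]_w (f w)%:E <= (b + k)%:E)%E.
Proof.
move=> b0 f0.
have kY w : 0 <= k * Y w by rewrite mulr_ge0// ltW.
have mYE : measurable_fun setT (EFin \o Y) by exact/measurable_EFinP.
have mkY : measurable_fun setT (fun w => (k * Y w)%:E).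
  by apply/measurable_EFinP; exact: measurable_funM.
apply: (@le_trans _ _ (\int[P]_w (b%:E + (k * Y w)%:E))%E).
  apply: ge0_le_integral => //.
  - by move=> w _; rewrite lee_fin.
  - exact/measurable_EFinP.
  - exact: emeasurable_funD.
  - move=> w _; rewrite -EFinD lee_fin; apply: le_trans (fY w) _.
    rewrite lerD2l ler_wpM2l//.
    have Y1 : -1 < Y w - 1 by have := Y0 w; lra.
    by have := le_ln1Dx Y1; rewrite subrKC; lra.
rewrite ge0_integralD//; [|by move=> w _; rewrite lee_fin..].
rewrite integral_cst//= probability_setT mule1.
under eq_integral do rewrite EFinM.
rewrite ge0_integralZl//; last by move=> w _; rewrite lee_fin ltW.
rewrite EFinD leeD// -[leRHS]mule1.
by apply: lee_wpmul2l => //; rewrite lee_fin.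
Qed.

End log_domination.

Section exponential_moment.
Context (R : realType) (n : nat) (sigma : R).
Context (d : measure_display) (Omega : measurableType d).
Context (P : probability Omega R) (xi : 'I_n -> {RV P >-> R}).
Hypothesis n3 : (3 <= n)%N.
Hypothesis sigma0 : 0 < sigma.
Hypothesis xiN : gaussian_noise sigma xi.
Variables (es : {set 'I_n} -> seq 'cV[R]_n) (J0 : {set 'I_n}).
Hypothesis size_es : forall J, (size (es J) <= #|J| + 2)%N.
Hypothesis es_on : forall J, orthonormal (es J).

(** The noise in [WJ (J :|: J0)] minus the penalty of [J], scaled so that its
exponential is integrable by [mgf_sumsq_noise]. *)
Definition excess J w : R :=
  9 / 50 / sigma ^+ 2 * sumsq (es (J :|: J0)%SET) (noise xi w) - 9 / 100 * penalty R J.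

(** The sum of exponentials replaces the maximum of the excesses. *)
Definition exp_excess_sum w : R := \sum_(J : {set 'I_n} | J \subset interior_idx n) expR (excess J w).

Lemma measurable_excess J : measurable_fun setT (excess J).
Proof.
apply: measurable_funB => //; apply: measurable_funM => //.
exact: (measurable_sumsq_noise xi).
Qed.

Lemma measurable_exp_excess_sum : measurable_fun setT exp_excess_sum.
Proof.
rewrite (_ : exp_excess_sum = fun w => \sum_(J <- seq.filter (fun J : {set 'I_n} => J \subset interior_idx n) (index_enum _))
    expR (excess J w)); last by apply/funext => w; rewrite big_filter.
by apply: measurable_sum => J; apply: measurableT_comp => //; exact: measurable_excess.
Qed.

Lemma excess_le_ln_sum (J : {set 'I_n}) w : J \subset interior_idx n -> excess J w <= ln (exp_excess_sum w).
Proof.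
move=> JI; have Z0 : expR (excess J w) <= exp_excess_sum w.
  by rewrite /exp_excess_sum (bigD1 J)//= lerDl sumr_ge0.
by rewrite -[leLHS]expRK ler_ln ?posrE ?expR_gt0// (lt_le_trans (expR_gt0 _) Z0).
Qed.

Lemma exp_excess_sum_gt0 w : 0 < exp_excess_sum w.
Proof.
rewrite /exp_excess_sum (bigD1 finset.set0) ?finset.sub0set//= ltr_pwDl ?expR_gt0// sumr_ge0//.
Qed.

(** The moment of the term [J] is at most [(5 / 4) ^+ (#|J| + #|J0| + 2)] times
the exponential of minus the scaled penalty.  The latter is at most
[nu J ^+ 4], and one factor [nu J] absorbs [(5 / 4) ^+ #|J|] because
[expR #|J| <= 1 / nu J].  There remains at most [(5 / 4) ^+ (#|J0| + 2) * nu J],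
and the [nu J] sum to one. *)
Lemma integral_exp_excess_sum_le :
  (\int[P]_w (exp_excess_sum w)%:E <= ((5 / 4) ^+ (#|J0| + 2))%:E)%E.
Proof.
have mexp J : measurable_fun setT (fun w => (expR (excess J w))%:E).
  by apply/measurable_EFinP; apply: measurableT_comp => //; exact: measurable_excess.
under eq_integral do rewrite /exp_excess_sum -sumEFin -big_filter.
rewrite ge0_integral_sum//.
rewrite big_filter -[X in X%:E]mulr1 -[X in (_ * X)%:E](sum_nu R n3) mulr_sumr -sumEFin.
apply: lee_sum => J JI.
set e := es (J :|: J0)%SET.
have -> : (\int[P]_w (expR (excess J w))%:E =
    (expR (- (9 / 100 * penalty R J)) * (5 / 4) ^+ size e)%:E)%E.
  have H := mgf_sumsq_noise sigma0 xiN (es_on (J :|: J0)%SET) (a := 0)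
    (fun e _ => dotv0r e).
  rewrite dotv0r mulr0 expR0 mulr1 in H.
  rewrite EFinM -H -ge0_integralZl//; last first.
    apply/measurable_EFinP; apply: measurableT_comp => //.
    apply: measurable_funD; first exact: (measurable_dotv_noise xi).
    by apply: measurable_funM => //; exact: (measurable_sumsq_noise xi).
  apply: eq_integral => w _; rewrite -EFinM -expRD dotvC dotv0r.
  by congr (expR _)%:E; rewrite /excess; ring.
rewrite lee_fin.
have g1 : 1 <= 5 / 4 :> R by lra.
have sz : (size e <= #|J| + (#|J0| + 2))%N.
  apply: leq_trans (size_es _) _; rewrite addnA leq_add2r cardsU; exact: leq_subr.
apply: (@le_trans _ _ (expR (- (9 / 100 * penalty R J)) * (5 / 4) ^+ (#|J| + (#|J0| + 2)))).
  by rewrite ler_wpM2l// ler_weXn2l.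
rewrite (exprD _ #|J|) mulrA [leLHS]mulrC ler_wpM2l//.
have H1 : (5 / 4) ^+ #|J| <= expR #|J|%:R :> R.
  rewrite -[X in expR X]mulr1 expRM_natl lerXn2r ?nnegrE ?expR_ge0//.
  by apply: le_trans (expR_ge1Dx 1); lra.
apply: le_trans (ler_wpM2l (expR_ge0 _) H1) _.
rewrite -expRD -[leRHS](lnK (nu_gt0 R n3 JI : nu R J \is Num.pos)) ler_expR.
have := ln_inv_nu_ge R n3 JI; rewrite /penalty div1r lnV ?posrE ?nu_gt0//.
have := ler0n R #|J|; lra.
Qed.

End exponential_moment.

(** [Y] is the sum of exponentials divided by its bound
[(5 / 4) ^+ (#|J0| + 2)]; the logarithm of this bound is of the order of
[#|J0|] and is absorbed in the oracle term. *)
Lemma Qconv_risk_bound (R : realType) (n : nat) (sigma : R) (mu u : 'cV[R]_n)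
    (d : measure_display) (Omega : measurableType d) (P : probability Omega R)
    (xi : 'I_n -> {RV P >-> R}) (muhat : 'cV[R]_n -> 'cV[R]_n) :
  (3 <= n)%N -> 0 < sigma -> gaussian_noise sigma xi ->
  is_Qconv_estimator sigma muhat ->
  exists Y : Omega -> R, [/\ measurable_fun setT Y, (forall w, 0 < Y w),
    (\int[P]_w (Y w)%:E <= 1%:E)%E &
    forall w, sqnorm (muhat (observation mu xi w) - mu) <=
      oracle 200 sigma mu u + 200 / 9 * sigma ^+ 2 / n%:R * ln (Y w)].
Proof.
move=> n3 s0 xiN muhatP.
have [es esP] := @choice {set 'I_n} (seq 'cV[R]_n) (fun J es =>
  [/\ (size es <= #|J| + 2)%N, orthonormal es &
      forall u, WJ J u -> u = \sum_(e <- es) dotv e u *: e])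
  (fun J => WJ_basis R J n3).
pose J0 := kinks u.
have J0I : J0 \subset interior_idx n by exact: kinks_interior.
pose Z := exp_excess_sum sigma xi es J0.
have mZ : measurable_fun setT Z by exact: measurable_exp_excess_sum.
pose a : R := (5 / 4) ^+ (#|J0| + 2).
have a0 : 0 < a by rewrite exprn_gt0//; lra.
have Z0 w : 0 < Z w by exact: exp_excess_sum_gt0.
have EZ : (\int[P]_w (Z w)%:E <= a%:E)%E.
  by apply: integral_exp_excess_sum_le => // J; have [] := esP J.
exists (fun w => a^-1 * Z w); split.
- exact: measurable_funM.
- by move=> w; rewrite mulr_gt0// invr_gt0.
- under eq_integral do rewrite EFinM.
  rewrite ge0_integralZl//; last 3 first.
  + exact/measurable_EFinP.
  + by move=> w _; rewrite lee_fin ltW.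
  + by rewrite lee_fin invr_ge0 ltW.
  by rewrite -lee_pdivlMl ?invr_gt0// invrK mule1.
move=> w; have sn0 : 0 < sigma ^+ 2 by rewrite exprn_gt0.
have nR : (0 : R) < n%:R by rewrite ltr0n; lia.
have Hex (J : {set 'I_n}) : J \subset interior_idx n ->
    2 * sumsq (es (J :|: J0)%SET) (noise xi w) - sigma ^+ 2 * penalty R J <=
    sigma ^+ 2 * (100 / 9 * ln (Z w)).
  move=> JI; have := excess_le_ln_sum sigma xi es J0 w JI; rewrite /excess -/Z.
  have c0 : 0 <= sigma ^+ 2 * (100 / 9) by rewrite mulr_ge0 ?ltW.
  move=> /(ler_wpM2l c0); congr (_ <= _).
    by field; rewrite gt_eqF.
  by ring.
have spanes J (v : 'cV[R]_n) : WJ J v -> v = \sum_(e <- es J) dotv e v *: e.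
  by have [_ _] := esP J; exact.
have := loss_deterministic n3 muhatP mu spanes J0I (@WJ_kinks _ _ u) Hex.
rewrite -/(observation mu xi w) => /le_trans; apply.
rewrite /oracle -addrA lerD2l.
have PL := penalty_le R n3 J0I.
have lna : ln a <= 4^-1 * (#|J0| + 2)%:R.
  rewrite /a lnXn; last lra.
  rewrite -[leLHS]mulr_natr ler_wpM2r//.
  by have := @le_ln1Dx R (4^-1) ltac:(lra); rewrite (_ : 1 + 4^-1 = 5 / 4)//; field.
have L1 : 1 <= logratio R n #|J0|.+1.
  by apply: logratio_ge1; rewrite /= card_kinks_lt.
have q1 : #|J0|.+1%:R <= #|J0|.+1%:R * logratio R n #|J0|.+1 by rewrite ler_peMr.
have -> : ln (a^-1 * Z w) = - ln a + ln (Z w).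
  by rewrite lnM ?posrE ?invr_gt0// lnV ?posrE.
rewrite -/(logratio R n (qkinks u)) /qkinks -/(kinks u) -/J0.
have -> : 200 * sigma ^+ 2 * #|J0|.+1%:R / n%:R * logratio R n #|J0|.+1 +
    200 / 9 * sigma ^+ 2 / n%:R * (- ln a + ln (Z w)) =
    sigma ^+ 2 / n%:R * (200 * (#|J0|.+1%:R * logratio R n #|J0|.+1) +
      200 / 9 * (ln (Z w) - ln a)) by ring.
rewrite ler_wpM2l//; first by rewrite divr_ge0// ltW.
move: PL q1; set T := #|J0|.+1%:R * _ => PL q1.
rewrite -natr1 in q1; rewrite natrD in lna.
have := ler0n R #|J0|; lra.
Qed.

Lemma oracle_ge0 (R : realType) n (c sigma : R) (mu u : 'cV[R]_n) :
  (3 <= n)%N -> 0 <= c -> 0 <= oracle c sigma mu u.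
Proof.
move=> n3 c0.
have L1 : 1 <= logratio R n (qkinks u) by rewrite logratio_ge1//= card_kinks_lt.
rewrite /oracle addr_ge0 ?sqnorm_ge0// mulr_ge0 ?(le_trans ler01 L1)//.
by rewrite divr_ge0 ?ler0n// mulr_ge0 ?ler0n// mulr_ge0// sqr_ge0.
Qed.

(** In expectation a remainder of order [sigma ^+ 2 / n] is left; it is absorbed
by enlarging the constant, as [q * logratio q] is at least one. *)
Lemma oracle_slack (R : realType) n (sigma : R) (mu u : 'cV[R]_n) : (3 <= n)%N ->
  oracle 200 sigma mu u + 200 / 9 * sigma ^+ 2 / n%:R <= oracle 223 sigma mu u.
Proof.
move=> n3.
have L1 : 1 <= logratio R n (qkinks u) by rewrite logratio_ge1//= card_kinks_lt.
have q0 : 1 <= (qkinks u)%:R * logratio R n (qkinks u) by rewrite mulr_ege1 ?ler1n.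
have r0 : 0 <= sigma ^+ 2 / n%:R by rewrite divr_ge0 ?sqr_ge0 ?ler0n.
rewrite /oracle -addrA lerD2l -/(logratio R n (qkinks u)).
move: r0 (ler_wpM2l r0 q0).
set L := logratio _ _ _; set q := (qkinks u)%:R; set r := sigma ^+ 2 / n%:R => {}r0 H.
have E c : c * sigma ^+ 2 * q / n%:R * L = c * (r * (q * L)) by rewrite /r; ring.
have E' : 200 / 9 * sigma ^+ 2 / n%:R = 200 / 9 * r by rewrite /r; ring.
rewrite !E E'; move: r (r * (q * L)) r0 H {E E'} => {}r T r0 H; lra.
Qed.

Theorem theorem6 (R : realType) :
  exists c c' : R, 0 < c /\ 0 < c' /\
  forall (n : nat) (sigma : R) (mu : 'cV[R]_n)
    (d : measure_display) (Omega : measurableType d) (P : probability Omega R)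
    (xi : 'I_n -> {RV P >-> R}) (muhat : 'cV[R]_n -> 'cV[R]_n),
  (3 <= n)%N -> 0 < sigma ->
  gaussian_noise sigma xi ->
  is_Qconv_estimator sigma muhat ->
  (exists m : R, is_minimum (oracle c sigma mu) m /\
     forall delta : R, 0 < delta < 1 / 3 ->
     ((1 - 3 * delta)%:E <=
        P [set w | sqnorm (muhat (observation mu xi w) - mu) <=
                    m + c * sigma ^+ 2 * ln (1 / delta) / n%:R]%R)%E) /\
  (exists m' : R, is_minimum (oracle c' sigma mu) m' /\
     ('E_P[fun w => sqnorm (muhat (observation mu xi w) - mu)%R] <= m'%:E)%E).
Proof.
have c0 : (0 : R) < 223 by lra.
exists 223, 223; split => //; split => // n sigma mu d Omega P xi muhat n3 s0 xiN muhatP.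
have [m mmin] := oracle_minimum sigma n3 mu (ltW c0).
have [[u um] _] := mmin.
have [Y [mY Y0 EY HY]] := Qconv_risk_bound mu u n3 s0 xiN muhatP.
have mloss := loss_measurable n3 muhatP mu xi.
have nR : (0 : R) < n%:R by rewrite ltr0n; lia.
have r0 : 0 < sigma ^+ 2 / n%:R by rewrite divr_gt0// exprn_gt0.
have k0 : 0 <= 200 / 9 * sigma ^+ 2 / n%:R.
  by rewrite -mulrA mulr_ge0 ?(ltW r0)//; lra.
have mbound : oracle 200 sigma mu u + 200 / 9 * sigma ^+ 2 / n%:R <= m.
  by rewrite -um; exact: oracle_slack.
have b0 : 0 <= oracle 200 sigma mu u by exact: oracle_ge0.
split; exists m; split => //.
- move=> delta /andP[d0 d1].
  apply: (@le_trans _ _ (1 - delta)%:E); first by rewrite lee_fin; lra.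
  apply: le_trans (log_domination_tail mloss mY Y0 EY k0 HY d0) _.
  apply: le_measure; rewrite ?inE; [exact: measurable_sublevel..|].
  move=> w /= /le_trans; apply.
  have ld : 0 <= ln (1 / delta) by rewrite ln_ge0// ler_pdivlMr//; lra.
  rewrite lerD//; first by apply: le_trans mbound; rewrite lerDl.
  rewrite (_ : 200 / 9 * sigma ^+ 2 / n%:R = 200 / 9 * (sigma ^+ 2 / n%:R)); last by ring.
  rewrite (_ : 223 * _ * _ / _ = 223 * (sigma ^+ 2 / n%:R) * ln (1 / delta)); last by ring.
  by rewrite ler_wpM2r// ler_wpM2r ?(ltW r0)//; lra.
- rewrite unlock.
  apply: le_trans (log_domination_expectation mloss mY Y0 EY k0 HY b0 _) _.
    by move=> w; exact: sqnorm_ge0.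
  by rewrite lee_fin.
Qed.
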